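(* Let $H$ be a quasi-Hopf algebra, $\mathcal{A}$ an $H$-bimodule algebra, $\mathbb{A}$ an $H$-bicomodule algebra, $B$ an associative algebra, $\gamma:\mathbb{A}\to B$ an algebra map and $v:\mathcal{A}\to B$ a linear map such that, for all $\varphi,\varphi'\in\mathcal{A}$ and $u\in\mathbb{A}$: $$\gamma(u_{<0>})v(\varphi\cdot u_{<1>})=v(u_{[-1]}\cdot\varphi)\gamma(u_{[0]}),$$ $$v(\varphi\varphi')=\gamma(\tilde X^1_\rho)\,v(\theta^1\tilde X^1_\lambda\cdot\varphi\cdot\tilde X^2_\rho)\,\gamma(\theta^2)\,v(\tilde X^2_\lambda\cdot\varphi'\cdot\tilde X^3_\rho\theta^3)\,\gamma(\tilde X^3_\lambda),$$ $$v(1_{\mathcal{A}})=1_B.$$ Then there exists a unique algebra map $w:\mathcal{A}\bowtie\mathbb{A}\to B$ such that $w\circ\Gamma=v$ and $w\circ j=\gamma$. Moreover, $w$ is given by the formula $$w(\varphi\bowtie u)=\gamma(\tilde q^1_\rho)\,v(\varphi\cdot\tilde q^2_\rho)\,\gamma(u)$$ for all $\varphi\in\mathcal{A}$, $u\in\mathbb{A}$.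
   Context: Throughout, $k$ is a field, all algebras and linear spaces are over $k$, $\otimes=\otimes_k$. A quasi-bialgebra $(H,\Delta,\varepsilon,\Phi)$ is a unital associative algebra $H$ with algebra maps $\Delta:H\to H\otimes H$, $\varepsilon:H\to k$ and an invertible $\Phi\in H^{\otimes 3}$ such that for all $h\in H$: $(id\otimes\Delta)(\Delta(h))=\Phi(\Delta\otimes id)(\Delta(h))\Phi^{-1}$; $(id\otimes\varepsilon)(\Delta(h))=h=(\varepsilon\otimes id)(\Delta(h))$; $(1\otimes\Phi)(id\otimes\Delta\otimes id)(\Phi)(\Phi\otimes 1)=(id\otimes id\otimes\Delta)(\Phi)(\Delta\otimes id\otimes id)(\Phi)$; $(\varepsilon\otimes id\otimes id)(\Phi)=(id\otimes\varepsilon\otimes id)(\Phi)=(id\otimes id\otimes\varepsilon)(\Phi)=1\otimes 1$. Notation (summation understood): $\Delta(h)=h_1\otimes h_2$; $\Phi=X^1\otimes X^2\otimes X^3$, $\Phi^{-1}=x^1\otimes x^2\otimes x^3$; lower indices denote components of $\Delta$. A quasi-Hopf algebra is a quasi-bialgebra $H$ with an algebra anti-automorphism $S$ and $\alpha,\beta\in H$ such that $S(h_1)\alpha h_2=\varepsilon(h)\alpha$, $h_1\beta S(h_2)=\varepsilon(h)\beta$ for all $h$, $X^1\beta S(X^2)\alpha X^3=1$, $S(x^1)\alpha x^2\beta S(x^3)=1$; normalised (as one may) so that $\varepsilon(\alpha)=\varepsilon(\beta)=1$ and $\varepsilon\circ S=\varepsilon$. Drinfeld twist: with $A^1\otimes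 A^2\otimes A^3\otimes A^4=(\Phi\otimes 1)(\Delta\otimes id\otimes id)(\Phi^{-1})$ and $\Delta^{cop}(h)=h_2\otimes h_1$, put $f=f^1\otimes f^2=(S\otimes S)(\Delta^{cop}(x^1))\,\big(S(A^2)\alpha A^3\otimes S(A^1)\alpha A^4\big)\,\Delta(x^2\beta S(x^3))\in H\otimes H$. An $H$-bimodule algebra is an $H$-bimodule $\mathcal{A}$ with a multiplication and usual unit $1_{\mathcal{A}}$ such that $(\varphi\psi)\xi=(X^1\cdot\varphi\cdot x^1)[(X^2\cdot\psi\cdot x^2)(X^3\cdot\xi\cdot x^3)]$, $h\cdot(\varphi\psi)=(h_1\cdot\varphi)(h_2\cdot\psi)$, $(\varphi\psi)\cdot h=(\varphi\cdot h_1)(\psi\cdot h_2)$, $h\cdot 1_{\mathcal{A}}=\varepsilon(h)1_{\mathcal{A}}=1_{\mathcal{A}}\cdot h$. A right $H$-comodule algebra is a unital associative algebra $\mathfrak{A}$ with an algebra map $\rho:\mathfrak{A}\to\mathfrak{A}\otimes H$, $\rho(u)=u_{<0>}\otimes u_{<1>}$, and an invertible $\Phi_\rho\in\mathfrak{A}\otimes H\otimes H$ such that $\Phi_\rho(\rho\otimes id)(\rho(u))=(id\otimes\Delta)(\rho(u))\Phi_\rho$; $(1\otimes\Phi)(id\otimes\Delta\otimes id)(\Phi_\rho)(\Phi_\rho\otimes 1)=(id\otimes id\otimes\Delta)(\Phi_\rho)(\rho\otimes id\otimes id)(\Phi_\rho)$; $(id\otimes\varepsilon)\circ\rho=id$;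 $(id\otimes\varepsilon\otimes id)(\Phi_\rho)=(id\otimes id\otimes\varepsilon)(\Phi_\rho)=1\otimes 1$. A left $H$-comodule algebra is a unital associative algebra $\mathfrak{B}$ with an algebra map $\lambda:\mathfrak{B}\to H\otimes\mathfrak{B}$, $\lambda(u)=u_{[-1]}\otimes u_{[0]}$, and an invertible $\Phi_\lambda\in H\otimes H\otimes\mathfrak{B}$ such that $(id\otimes\lambda)(\lambda(u))\Phi_\lambda=\Phi_\lambda(\Delta\otimes id)(\lambda(u))$; $(1\otimes\Phi_\lambda)(id\otimes\Delta\otimes id)(\Phi_\lambda)(\Phi\otimes 1)=(id\otimes id\otimes\lambda)(\Phi_\lambda)(\Delta\otimes id\otimes id)(\Phi_\lambda)$; $(\varepsilon\otimes id)\circ\lambda=id$; $(id\otimes\varepsilon\otimes id)(\Phi_\lambda)=(\varepsilon\otimes id\otimes id)(\Phi_\lambda)=1\otimes 1$. An $H$-bicomodule algebra is an algebra $\mathbb{A}$ with $(\lambda,\rho,\Phi_\lambda,\Phi_\rho,\Phi_{\lambda,\rho})$ such that $(\mathbb{A},\lambda,\Phi_\lambda)$ is a left and $(\mathbb{A},\rho,\Phi_\rho)$ a right $H$-comodule algebra and $\Phi_{\lambda,\rho}\in H\otimes\mathbb{A}\otimes H$ is invertible with $\Phi_{\lambda,\rho}(\lambda\otimes id)(\rho(u))=(id\otimes\rho)(\lambda(u))\Phi_{\lambda,\rho}$; $(1\otimes\Phi_{\lambda,\rho})(id\otimes\lambda\otimes id)(\Phi_{\lambda,\rho})(\Phi_\lambda\otimes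 1)=(id\otimes id\otimes\rho)(\Phi_\lambda)(\Delta\otimes id\otimes id)(\Phi_{\lambda,\rho})$; $(1\otimes\Phi_\rho)(id\otimes\rho\otimes id)(\Phi_{\lambda,\rho})(\Phi_{\lambda,\rho}\otimes 1)=(id\otimes id\otimes\Delta)(\Phi_{\lambda,\rho})(\lambda\otimes id\otimes id)(\Phi_\rho)$. Write $\Phi_\rho=\tilde X^1_\rho\otimes\tilde X^2_\rho\otimes\tilde X^3_\rho$, $\Phi_\rho^{-1}=\tilde x^1_\rho\otimes\tilde x^2_\rho\otimes\tilde x^3_\rho$, $\Phi_\lambda=\tilde X^1_\lambda\otimes\tilde X^2_\lambda\otimes\tilde X^3_\lambda$, $\Phi_\lambda^{-1}=\tilde x^1_\lambda\otimes\tilde x^2_\lambda\otimes\tilde x^3_\lambda$, $\Phi_{\lambda,\rho}^{-1}=\theta^1\otimes\theta^2\otimes\theta^3$, and $\tilde p_\rho=\tilde p^1_\rho\otimes\tilde p^2_\rho=\tilde x^1_\rho\otimes\tilde x^2_\rho\beta S(\tilde x^3_\rho)$, $\tilde q_\rho=\tilde q^1_\rho\otimes\tilde q^2_\rho=\tilde X^1_\rho\otimes S^{-1}(\alpha\tilde X^3_\rho)\tilde X^2_\rho$ in $\mathbb{A}\otimes H$. The generalized diagonal crossed product $\mathcal{A}\bowtie\mathbb{A}$ is $\mathcal{A}\otimes\mathbb{A}$ with unit $1_{\mathcal{A}}\bowtie 1_{\mathbb{A}}$ and the associative multiplication $(\varphi\bowtie u)(\varphi'\bowtie u')=(\Omega^1\cdot\varphi\cdot\Omega^5)(\Omega^2u_{<0>_{[-1]}}\cdot\varphi'\cdot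 S^{-1}(u_{<1>})\Omega^4)\bowtie\Omega^3u_{<0>_{[0]}}u'$, where $$\Omega^1\otimes\cdots\otimes\Omega^5=(\tilde X^1_\rho)_{[-1]_1}\tilde x^1_\lambda\theta^1\otimes(\tilde X^1_\rho)_{[-1]_2}\tilde x^2_\lambda\theta^2_{[-1]}\otimes(\tilde X^1_\rho)_{[0]}\tilde x^3_\lambda\theta^2_{[0]}\otimes S^{-1}(f^1\tilde X^2_\rho\theta^3)\otimes S^{-1}(f^2\tilde X^3_\rho).$$ The maps $\Gamma:\mathcal{A}\to\mathcal{A}\bowtie\mathbb{A}$ and $j:\mathbb{A}\to\mathcal{A}\bowtie\mathbb{A}$ are $\Gamma(\varphi)=(\tilde p^1_\rho)_{[-1]}\cdot\varphi\cdot S^{-1}(\tilde p^2_\rho)\bowtie(\tilde p^1_\rho)_{[0]}$ and $j(u)=1_{\mathcal{A}}\bowtie u$. *)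

(* Defs.v *)
(* Classical logic is used to form quotients and to choose a linear form. *)
From HB Require Import structures.
From mathcomp Require Import all_boot all_order all_algebra.
From mathcomp Require Import boolp classical_sets.

Set Implicit Arguments.
Unset Strict Implicit.
Unset Printing Implicit Defensive.

Import GRing.Theory.
Local Open Scope ring_scope.
Local Open Scope quotient_scope.

Section Tensor.
Variable k : fieldType.

Definition bilin (U V W : lmodType k) (f : U -> V -> W) : Prop :=
  (forall v, linear (f^~ v)) /\ (forall u, linear (f u)).

Variables U V : lmodType k.

(* A list [:: (u1, v1); (u2, v2)] stands for u1 ⊗ v1 + u2 ⊗ v2; two lists are
   identified iff no bilinear map distinguishes the corresponding sums. *)
Definition tensor_rel : rel (seq (U * V)) := fun s t =>
  `[< forall (W : lmodType k) (f : U -> V -> W), bilin f ->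
      \sum_(p <- s) f p.1 p.2 = \sum_(p <- t) f p.1 p.2 >].

Lemma tensor_rel_refl : reflexive tensor_rel.
Proof. by move=> s; apply/asboolP. Qed.

Lemma tensor_rel_sym : symmetric tensor_rel.
Proof.
by move=> s t; apply/asboolP/asboolP => st W f bf; rewrite (st W f bf).
Qed.

Lemma tensor_rel_trans : transitive tensor_rel.
Proof.
move=> t s r /asboolP st /asboolP tr; apply/asboolP => W f bf.
by rewrite (st W f bf) (tr W f bf).
Qed.

Canonical tensor_equiv :=
  EquivRel tensor_rel tensor_rel_refl tensor_rel_sym tensor_rel_trans.

Definition tensor := {eq_quot tensor_equiv}.

HB.instance Definition _ := Choice.on tensor.
HB.instance Definition _ := EqQuotient.on tensor.

Definition tens (u : U) (v : V) : tensor := \pi_tensor [:: (u, v)].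

(* Sweedler notation: [tsum t f] is the sum of f t^1 t^2 where t^1 ⊗ t^2
   (summation understood) is the chosen representative of t. When f is bilinear
   the value does not depend on the representative: see [tsum_pi]. *)
Definition tsum (W : nmodType) (t : tensor) (f : U -> V -> W) : W :=
  \sum_(p <- repr t) f p.1 p.2.

Lemma tsum_pi (W : lmodType k) (f : U -> V -> W) (s : seq (U * V)) :
  bilin f -> tsum (\pi_tensor s) f = \sum_(p <- s) f p.1 p.2.
Proof.
move=> bf; rewrite /tsum.
have : (repr (\pi_tensor s) = s %[mod tensor]) by rewrite reprK.
by move=> /eqmodP /asboolP /(_ W f bf).
Qed.

Lemma tensor_ext (x y : tensor) :
  (forall (W : lmodType k) (f : U -> V -> W), bilin f -> tsum x f = tsum y f) ->
  x = y.
Proof.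
by move=> xy; rewrite -[x]reprK -[y]reprK; apply/eqmodP/asboolP => W f /xy.
Qed.

Definition tensor_add (x y : tensor) : tensor := \pi_tensor (repr x ++ repr y).
Definition tensor_scale (c : k) (x : tensor) : tensor :=
  \pi_tensor [seq (c *: p.1, p.2) | p <- repr x].

Lemma tsum_nil (W : lmodType k) (f : U -> V -> W) :
  bilin f -> tsum (\pi_tensor [::]) f = 0.
Proof. by move=> bf; rewrite tsum_pi// big_nil. Qed.

Lemma tsum_add (W : lmodType k) (f : U -> V -> W) x y :
  bilin f -> tsum (tensor_add x y) f = tsum x f + tsum y f.
Proof. by move=> bf; rewrite tsum_pi// big_cat. Qed.

Lemma bilinZl (W : lmodType k) (f : U -> V -> W) c u v :
  bilin f -> f (c *: u) v = c *: f u v.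
Proof.
move=> [fl _]; have f0 : f 0 v = 0.
  by have := fl v 1 0 0; rewrite /= !scale1r addr0 -[LHS]addr0 => /addrI /esym.
by have := fl v c u 0; rewrite /= f0 !addr0.
Qed.

Lemma bilinZr (W : lmodType k) (f : U -> V -> W) c u v :
  bilin f -> f u (c *: v) = c *: f u v.
Proof.
move=> [_ fr]; have f0 : f u 0 = 0.
  by have := fr u 1 0 0; rewrite /= !scale1r addr0 -[LHS]addr0 => /addrI /esym.
by have := fr u c v 0; rewrite /= f0 !addr0.
Qed.

Lemma tsum_scale (W : lmodType k) (f : U -> V -> W) c x :
  bilin f -> tsum (tensor_scale c x) f = c *: tsum x f.
Proof.
move=> bf; rewrite tsum_pi// big_map scaler_sumr.
by apply: eq_bigr => p _ /=; rewrite bilinZl.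
Qed.

Definition tsumE := (tsum_nil, tsum_add, tsum_scale).

Fact tensor_addA : associative tensor_add.
Proof. by move=> x y z; apply: tensor_ext => W f bf; rewrite !tsumE// addrA. Qed.
Fact tensor_addC : commutative tensor_add.
Proof. by move=> x y; apply: tensor_ext => W f bf; rewrite !tsumE// addrC. Qed.
Fact tensor_add0 : left_id (\pi_tensor [::]) tensor_add.
Proof. by move=> x; apply: tensor_ext => W f bf; rewrite !tsumE// add0r. Qed.
Fact tensor_addN :
  left_inverse (\pi_tensor [::]) (tensor_scale (-1)) tensor_add.
Proof.
by move=> x; apply: tensor_ext => W f bf; rewrite !tsumE// scaleN1r addNr.
Qed.

HB.instance Definition _ := GRing.isZmodule.Build tensor
  tensor_addA tensor_addC tensor_add0 tensor_addN.

Lemma tsumD (W : lmodType k) (f : U -> V -> W) x y :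
  bilin f -> tsum (x + y) f = tsum x f + tsum y f.
Proof. exact: tsum_add. Qed.

Fact tensor_scaleA a b x :
  tensor_scale a (tensor_scale b x) = tensor_scale (a * b) x.
Proof. by apply: tensor_ext => W f bf; rewrite !tsumE// scalerA. Qed.
Fact tensor_scale1 : left_id 1 tensor_scale.
Proof. by move=> x; apply: tensor_ext => W f bf; rewrite !tsumE// scale1r. Qed.
Fact tensor_scaleDr : right_distributive tensor_scale +%R.
Proof.
by move=> c x y; apply: tensor_ext => W f bf; rewrite !(tsumE, tsumD)// scalerDr.
Qed.
Fact tensor_scaleDl x : {morph tensor_scale^~ x : a b / a + b}.
Proof.
by move=> a b; apply: tensor_ext => W f bf; rewrite !(tsumE, tsumD)// scalerDl.
Qed.

HB.instance Definition _ := GRing.Zmodule_isLmodule.Build k tensor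
  tensor_scaleA tensor_scale1 tensor_scaleDr tensor_scaleDl.

Lemma tsum_linear (W : lmodType k) (f : U -> V -> W) :
  bilin f -> linear (fun t : tensor => tsum t f).
Proof. by move=> bf c x y /=; rewrite tsumD// tsum_scale. Qed.

Lemma tsum_tens (W : lmodType k) (f : U -> V -> W) u v :
  bilin f -> tsum (tens u v) f = f u v.
Proof. by move=> bf; rewrite tsum_pi// big_seq1. Qed.

Lemma tens_bilin : bilin tens.
Proof.
split=> [v|u] c x y; apply: tensor_ext => W f bf;
  by rewrite tsum_linear// !tsum_tens//; have [fl fr] := bf; rewrite ?fl ?fr.
Qed.

Lemma tensor_sum (t : tensor) : t = tsum t tens.
Proof.
apply: tensor_ext => W f bf; rewrite {1}/tsum {2}/tsum.
elim: (repr t) => [|p s IH]; first by rewrite !big_nil tsum_nil.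
by rewrite !big_cons tsumD// -IH tsum_tens.
Qed.

Lemma tensor_ind (P : tensor -> Prop) :
  P 0 -> (forall x y, P x -> P y -> P (x + y)) -> (forall u v, P (tens u v)) ->
  forall t, P t.
Proof.
by move=> P0 PD Pt t; rewrite (tensor_sum t) /tsum; apply: big_ind.
Qed.

End Tensor.

Arguments tensor {k} (U V)%_type.

Notation "U ⊗ V" := (tensor U V)
  (at level 42, right associativity) : type_scope.
Notation "u ⊗ v" := (tens u v)
  (at level 42, right associativity) : ring_scope.

Notation "'\tsum_' ( a , b '<-' t ) E" := (tsum t (fun a b => E))
  (at level 43, a name, b name, t at level 60, E at level 43,
   format "'\tsum_' ( a ,  b  '<-'  t )  E") : ring_scope.
Notation "'\tsum_' ( a , b , c '<-' t ) E" :=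
  (tsum t (fun a t' => tsum t' (fun b c => E)))
  (at level 43, a name, b name, c name, t at level 60, E at level 43,
   format "'\tsum_' ( a ,  b ,  c  '<-'  t )  E") : ring_scope.
Notation "'\tsum_' ( a , b , c , d '<-' t ) E" :=
  (tsum t (fun a t' => tsum t' (fun b t'' => tsum t'' (fun c d => E))))
  (at level 43, a name, b name, c name, d name, t at level 60, E at level 43,
   format "'\tsum_' ( a ,  b ,  c ,  d  '<-'  t )  E") : ring_scope.
Notation "'\tsum_' ( a , b , c , d , e '<-' t ) E" :=
  (tsum t (fun a t' => tsum t' (fun b t'' => tsum t'' (fun c t3 =>
     tsum t3 (fun d e => E)))))
  (at level 43, a name, b name, c name, d name, e name, t at level 60,
   E at level 43,
   format "'\tsum_' ( a ,  b ,  c ,  d ,  e  '<-'  t )  E") : ring_scope.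

(* Used for the nontriviality required of a ring in [tensor_one_neq0]. *)
Lemma linear_form_exists (k : fieldType) (U : lmodType k) (u0 : U) :
  u0 != 0 -> exists2 f : U -> k^o, linear f & f u0 = 1.
Proof.
move=> u0N0.
pose subsp (S : set U) := S 0 /\ forall c x y, S x -> S y -> S (c *: x + y).
pose T := {S : set U | subsp S /\ ~ S u0}.
have T0 : T.
  exists [set 0]%classic; split; first split => //.
    by move=> c x y -> ->; rewrite scaler0 addr0.
  by move=> u00; rewrite u00 eqxx in u0N0.
pose le (S S' : T) := `[< (sval S `<=` sval S')%classic >].
have [||||M Mmax] := @Zorn T le.
- by move=> S; apply/asboolP.
- by move=> S1 S2 S3 /asboolP h /asboolP h'; apply/asboolP => x /h /h'.
- move=> [S1 p1] [S2 p2] /asboolP h /asboolP h'.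
  have e : S1 = S2 by apply/seteqP; split.
  by case: _ / e p2 {h h'} => p2; congr exist; apply: Prop_irrelevance.
- move=> C Ctot; have [[S0 CS0]|C0] := pselect (exists S, C S); last first.
    by exists T0 => S CS; exfalso; apply: C0; exists S.
  pose X := [set x | exists2 S : T, C S & sval S x]%classic.
  have Xok : subsp X /\ ~ X u0.
    split; [split|].
    - by exists S0 => //; case: (svalP S0) => -[].
    - move=> c x y [S CS Sx] [S' CS' Sy].
      have [/asboolP h|/asboolP h] := Ctot _ _ CS CS'.
        by exists S' => //; case: (svalP S') => -[_ hS'] _; apply: hS' => //; apply: h.
      by exists S => //; case: (svalP S) => -[_ hS] _; apply: hS => //; apply: h.
    - by move=> [S _ Su]; case: (svalP S).
  by exists (exist _ X Xok) => S CS; apply/asboolP => x Sx; exists S.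
have [[M0 Mlin] Mu0] := svalP M; set N := sval M in M0 Mlin Mu0.
have dec x : exists c, N (x - c *: u0).
  have [Nx|Nx] := pselect (N x); first by exists 0; rewrite scale0r subr0.
  pose N' := [set z | exists a, N (z - a *: x)]%classic.
  have sN' : subsp N'.
    split; first by exists 0; rewrite scale0r subr0.
    move=> c y z [a ya] [b zb]; exists (c * a + b).
    rewrite (_ : _ - _ = c *: (y - a *: x) + (z - b *: x)); first exact: Mlin.
    by rewrite scalerBr scalerA scalerDl opprD addrACA.
  have [[a Na]|N'u0] := pselect (N' u0).
    have aN0 : a != 0.
      by apply/eqP => a0; apply: Mu0; move: Na; rewrite a0 scale0r subr0.
    exists a^-1; have := Mlin (- a^-1) _ _ Na M0.
    by rewrite addr0 scalerBr !scaleNr opprK scalerA mulVf// scale1r addrC.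
  exfalso; apply: Nx.
  pose MN : T := exist _ N' (conj sN' N'u0).
  have /Mmax /(congr1 sval) /= eN : le M MN.
    by apply/asboolP => z Nz; exists 0; rewrite scale0r subr0.
  by rewrite /N -eN; exists 1; rewrite scale1r subrr.
have uniq x c d : N (x - c *: u0) -> N (x - d *: u0) -> c = d.
  move=> Nc Nd; apply/eqP; rewrite -subr_eq0; apply/negPn/negP => cd.
  apply: Mu0; have := Mlin (-1) _ _ Nc Nd.
  rewrite scaleN1r opprB addrA subrK -scalerBl => /Mlin /(_ M0).
  by move=> /(_ (c - d)^-1); rewrite addr0 scalerA mulVf// scale1r.
pose f x : k^o := projT1 (cid (dec x)).
have fP x : N (x - f x *: u0) by rewrite /f; case: cid.
exists f; last by apply: uniq (fP u0) _; rewrite scale1r subrr.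
move=> c x y; apply: uniq (fP _) _.
rewrite (_ : _ - _ = c *: (x - f x *: u0) + (y - f y *: u0)); first exact: Mlin.
by rewrite scalerBr scalerA scalerDl opprD addrACA.
Qed.

Section TensorAlgebra.
Variables (k : fieldType) (A B : algType k).

Definition tensor_mul (x y : A ⊗ B) : A ⊗ B :=
  \tsum_(a, b <- x) \tsum_(c, d <- y) (a * c) ⊗ (b * d).

Let tensDl (u u' : A) (v : B) : (u + u') ⊗ v = u ⊗ v + u' ⊗ v.
Proof. by have [/(_ v 1 u u')] := tens_bilin A B; rewrite !scale1r. Qed.
Let tensDr (u : A) (v v' : B) : u ⊗ (v + v') = u ⊗ v + u ⊗ v'.
Proof. by have [_ /(_ u 1 v v')] := tens_bilin A B; rewrite !scale1r. Qed.
Let tensZl c (u : A) (v : B) : (c *: u) ⊗ v = c *: (u ⊗ v).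
Proof. exact: bilinZl (tens_bilin A B). Qed.
Let tensZr c (u : A) (v : B) : u ⊗ (c *: v) = c *: (u ⊗ v).
Proof. exact: bilinZr (tens_bilin A B). Qed.

Let mul_bilin_r (a : A) (b : B) : bilin (fun (c : A) (d : B) => (a * c) ⊗ (b * d)).
Proof.
split=> [d|c] z x y /=.
  by rewrite mulrDr -scalerAr tensDl tensZl.
by rewrite mulrDr -scalerAr tensDr tensZr.
Qed.

Let mul_bilin_l (y : A ⊗ B) :
  bilin (fun (a : A) (b : B) => \tsum_(c, d <- y) (a * c) ⊗ (b * d)).
Proof.
split=> [b|a] z u v /=; rewrite /tsum scaler_sumr -big_split /=;
  apply: eq_bigr => p _.
  by rewrite mulrDl -scalerAl tensDl tensZl.
by rewrite mulrDl -scalerAl tensDr tensZr.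
Qed.

Lemma tensor_mulDl : left_distributive tensor_mul +%R.
Proof. by move=> x y z; rewrite /tensor_mul tsumD. Qed.

Lemma tensor_mulDr : right_distributive tensor_mul +%R.
Proof.
move=> x y z; rewrite /tensor_mul {1 3 5}/tsum -big_split /=.
by apply: eq_bigr => p _; rewrite tsumD.
Qed.

Lemma tensor_mul_tens (a c : A) (b d : B) :
  tensor_mul (a ⊗ b) (c ⊗ d) = (a * c) ⊗ (b * d).
Proof. by rewrite /tensor_mul !tsum_tens. Qed.

Let mul0 x : tensor_mul 0 x = 0.
Proof. by apply: (addrI (tensor_mul 0 x)); rewrite -tensor_mulDl !addr0. Qed.
Let mulx0 x : tensor_mul x 0 = 0.
Proof. by apply: (addrI (tensor_mul x 0)); rewrite -tensor_mulDr !addr0. Qed.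

Lemma tensor_mulA : associative tensor_mul.
Proof.
elim/tensor_ind => [|x x' IHx IHx'|a b] y z; first by rewrite !mul0.
  by rewrite !tensor_mulDl IHx IHx'.
elim/tensor_ind: y => [|y y' IHy IHy'|c d]; first by rewrite mulx0 !mul0 mulx0.
  by rewrite tensor_mulDr !tensor_mulDl tensor_mulDr IHy IHy'.
elim/tensor_ind: z => [|z z' IHz IHz'|e f]; first by rewrite !mulx0.
  by rewrite !tensor_mulDr IHz IHz'.
by rewrite !tensor_mul_tens !mulrA.
Qed.

Lemma tensor_mul1x : left_id (1 ⊗ 1) tensor_mul.
Proof.
elim/tensor_ind => [|x y IHx IHy|a b]; first by rewrite mulx0.
  by rewrite tensor_mulDr IHx IHy.
by rewrite tensor_mul_tens !mul1r.
Qed.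

Lemma tensor_mulx1 : right_id (1 ⊗ 1) tensor_mul.
Proof.
elim/tensor_ind => [|x y IHx IHy|a b]; first by rewrite mul0.
  by rewrite tensor_mulDl IHx IHy.
by rewrite tensor_mul_tens !mulr1.
Qed.

Lemma tensor_one_neq0 : 1 ⊗ 1 != 0 :> A ⊗ B.
Proof.
have [f fl f1] := linear_form_exists (oner_neq0 A).
have [g gl g1] := linear_form_exists (oner_neq0 B).
have bfg : bilin (fun (a : A) (b : B) => f a * g b : k^o).
  split=> [b|a] c x y /=.
    by rewrite fl mulrDl scalerAl.
  by rewrite gl mulrDr scalerAr.
apply/eqP => /(congr1 (fun t => tsum t (fun a b => f a * g b : k^o))).
rewrite tsum_tens// tsum_nil// f1 g1 mulr1.
by move/eqP; rewrite oner_eq0.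
Qed.

HB.instance Definition _ := GRing.Zmodule_isNzRing.Build (A ⊗ B)%type
  tensor_mulA tensor_mul1x tensor_mulx1 tensor_mulDl tensor_mulDr
  tensor_one_neq0.

Lemma tensor_scalerAl (c : k) (x y : A ⊗ B) : c *: (x * y) = (c *: x) * y.
Proof. by rewrite /GRing.mul /= /tensor_mul tsum_scale. Qed.

Lemma tensor_scalerAr (c : k) (x y : A ⊗ B) : c *: (x * y) = x * (c *: y).
Proof.
by rewrite [LHS]scaler_sumr; apply: eq_bigr => p _; rewrite tsum_scale.
Qed.

HB.instance Definition _ := GRing.Lmodule_isLalgebra.Build k (A ⊗ B)%type
  tensor_scalerAl.
HB.instance Definition _ := GRing.Lalgebra_isAlgebra.Build k (A ⊗ B)%type
  tensor_scalerAr.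

Lemma mulr_tens (a c : A) (b d : B) :
  (a ⊗ b) * (c ⊗ d) = (a * c) ⊗ (b * d).
Proof. exact: tensor_mul_tens. Qed.

Lemma tens11 : 1 ⊗ 1 = 1 :> A ⊗ B.
Proof. by []. Qed.

End TensorAlgebra.

(* Iterated tensor products are nested to the right, e.g. Phi : H ⊗ (H ⊗ H). *)
Record quasiBialgebra (k : fieldType) (H : algType k) := QuasiBialgebra {
  Delta : {lrmorphism H -> H ⊗ H};
  eps : {lrmorphism H -> k | *%R};
  Phi : H ⊗ H ⊗ H;
  PhiV : H ⊗ H ⊗ H;
  mulPhiV : Phi * PhiV = 1;
  mulVPhi : PhiV * Phi = 1;
  quasi_coassoc : forall h : H,
    (\tsum_(h1, h2 <- Delta h) h1 ⊗ Delta h2) =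
    Phi * (\tsum_(h1, h2 <- Delta h) \tsum_(a, b <- Delta h1) a ⊗ b ⊗ h2) * PhiV;
  counitr : forall h : H, (\tsum_(h1, h2 <- Delta h) eps h2 *: h1) = h;
  counitl : forall h : H, (\tsum_(h1, h2 <- Delta h) eps h1 *: h2) = h;
  Phi_cocycle :
    (1 ⊗ Phi)
    * (\tsum_(a, b, c <- Phi) \tsum_(b1, b2 <- Delta b) a ⊗ b1 ⊗ b2 ⊗ c)
    * (\tsum_(a, b, c <- Phi) a ⊗ b ⊗ c ⊗ 1) =
    (\tsum_(a, b, c <- Phi) a ⊗ b ⊗ Delta c)
    * (\tsum_(a, b, c <- Phi) \tsum_(a1, a2 <- Delta a) a1 ⊗ a2 ⊗ b ⊗ c);
  Phi_counit1 : (\tsum_(a, b, c <- Phi) eps a *: (b ⊗ c)) = 1 ⊗ 1;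
  Phi_counit2 : (\tsum_(a, b, c <- Phi) eps b *: (a ⊗ c)) = 1 ⊗ 1;
  Phi_counit3 : (\tsum_(a, b, c <- Phi) eps c *: (a ⊗ b)) = 1 ⊗ 1
}.

Record quasiHopf (k : fieldType) (H : algType k) := QuasiHopf {
  quasiHopf_base :> quasiBialgebra H;
  S : {linear H -> H};
  SV : H -> H;
  S_bijl : cancel S SV;
  S_bijr : cancel SV S;
  S_one : S 1 = 1;
  S_mul : forall g h : H, S (g * h) = S h * S g;
  alpha : H;
  beta : H;
  antipode_alpha : forall h : H,
    (\tsum_(h1, h2 <- Delta quasiHopf_base h) S h1 * alpha * h2) =
    eps quasiHopf_base h *: alpha;
  antipode_beta : forall h : H,
    (\tsum_(h1, h2 <- Delta quasiHopf_base h) h1 * beta * S h2) =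
    eps quasiHopf_base h *: beta;
  antipode_Phi :
    (\tsum_(X1, X2, X3 <- Phi quasiHopf_base)
       X1 * beta * S X2 * alpha * X3) = 1;
  antipode_PhiV :
    (\tsum_(x1, x2, x3 <- PhiV quasiHopf_base)
       S x1 * alpha * x2 * beta * S x3) = 1;
  eps_alpha : eps quasiHopf_base alpha = 1;
  eps_beta : eps quasiHopf_base beta = 1;
  eps_S : forall h : H, eps quasiHopf_base (S h) = eps quasiHopf_base h
}.

Section DrinfeldTwist.
Variables (k : fieldType) (H : algType k) (Q : quasiHopf H).

Definition twist_A : H ⊗ H ⊗ H ⊗ H :=
  (\tsum_(X1, X2, X3 <- Phi Q) X1 ⊗ X2 ⊗ X3 ⊗ 1)
  * (\tsum_(x1, x2, x3 <- PhiV Q) \tsum_(y1, y2 <- Delta Q x1)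
       y1 ⊗ y2 ⊗ x2 ⊗ x3).

Definition twist_f : H ⊗ H :=
  \tsum_(x1, x2, x3 <- PhiV Q)
    ((\tsum_(y1, y2 <- Delta Q x1) S Q y2 ⊗ S Q y1)
     * (\tsum_(A1, A2, A3, A4 <- twist_A)
          (S Q A2 * alpha Q * A3) ⊗ (S Q A1 * alpha Q * A4))
     * Delta Q (x2 * beta Q * S Q x3)).

End DrinfeldTwist.

Record bimoduleAlgebra (k : fieldType) (H : algType k) (Q : quasiBialgebra H)
    (AA : lmodType k) := BimoduleAlgebra {
  lact : H -> AA -> AA;
  ract : AA -> H -> AA;
  biact := fun (g : H) (phi : AA) (h : H) => ract (lact g phi) h;
  bmul : AA -> AA -> AA;
  bone : AA;
  lact_bilin : bilin lact;
  ract_bilin : bilin ract;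
  lact1 : forall phi, lact 1 phi = phi;
  ract1 : forall phi, ract phi 1 = phi;
  lactM : forall g h phi, lact (g * h) phi = lact g (lact h phi);
  ractM : forall g h phi, ract phi (g * h) = ract (ract phi g) h;
  lact_ract : forall g h phi, lact g (ract phi h) = ract (lact g phi) h;
  bmul_bilin : bilin bmul;
  bmul1l : left_id bone bmul;
  bmul1r : right_id bone bmul;
  bmul_quasi_assoc : forall phi psi xi,
    bmul (bmul phi psi) xi =
    \tsum_(X1, X2, X3 <- Phi Q) \tsum_(x1, x2, x3 <- PhiV Q)
      bmul (biact X1 phi x1) (bmul (biact X2 psi x2) (biact X3 xi x3));
  lact_bmul : forall h phi psi,
    lact h (bmul phi psi) =
    \tsum_(h1, h2 <- Delta Q h) bmul (lact h1 phi) (lact h2 psi);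
  ract_bmul : forall h phi psi,
    ract (bmul phi psi) h =
    \tsum_(h1, h2 <- Delta Q h) bmul (ract phi h1) (ract psi h2);
  lact_bone : forall h, lact h bone = eps Q h *: bone;
  ract_bone : forall h, ract bone h = eps Q h *: bone
}.

Record rightComoduleAlgebra (k : fieldType) (H : algType k)
    (Q : quasiBialgebra H) (A : algType k) := RightComoduleAlgebra {
  rho : {lrmorphism A -> A ⊗ H};
  Phi_rho : A ⊗ H ⊗ H;
  PhiV_rho : A ⊗ H ⊗ H;
  mulPhiV_rho : Phi_rho * PhiV_rho = 1;
  mulVPhi_rho : PhiV_rho * Phi_rho = 1;
  rho_quasi_coassoc : forall u : A,
    Phi_rho * (\tsum_(a, h <- rho u) \tsum_(b, g <- rho a) b ⊗ g ⊗ h) =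
    (\tsum_(a, h <- rho u) a ⊗ Delta Q h) * Phi_rho;
  rho_cocycle :
    (1 ⊗ Phi Q)
    * (\tsum_(a, g, h <- Phi_rho) \tsum_(g1, g2 <- Delta Q g)
         a ⊗ g1 ⊗ g2 ⊗ h)
    * (\tsum_(a, g, h <- Phi_rho) a ⊗ g ⊗ h ⊗ 1) =
    (\tsum_(a, g, h <- Phi_rho) a ⊗ g ⊗ Delta Q h)
    * (\tsum_(a, g, h <- Phi_rho) \tsum_(b, l <- rho a) b ⊗ l ⊗ g ⊗ h);
  rho_counit : forall u : A, (\tsum_(a, h <- rho u) eps Q h *: a) = u;
  Phi_rho_counit2 : (\tsum_(a, g, h <- Phi_rho) eps Q g *: (a ⊗ h)) = 1 ⊗ 1;
  Phi_rho_counit3 : (\tsum_(a, g, h <- Phi_rho) eps Q h *: (a ⊗ g)) = 1 ⊗ 1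
}.

Record leftComoduleAlgebra (k : fieldType) (H : algType k)
    (Q : quasiBialgebra H) (A : algType k) := LeftComoduleAlgebra {
  lambda : {lrmorphism A -> H ⊗ A};
  Phi_lambda : H ⊗ H ⊗ A;
  PhiV_lambda : H ⊗ H ⊗ A;
  mulPhiV_lambda : Phi_lambda * PhiV_lambda = 1;
  mulVPhi_lambda : PhiV_lambda * Phi_lambda = 1;
  lambda_quasi_coassoc : forall u : A,
    (\tsum_(h, a <- lambda u) h ⊗ lambda a) * Phi_lambda =
    Phi_lambda
    * (\tsum_(h, a <- lambda u) \tsum_(h1, h2 <- Delta Q h) h1 ⊗ h2 ⊗ a);
  lambda_cocycle :
    (1 ⊗ Phi_lambda)
    * (\tsum_(g, h, a <- Phi_lambda) \tsum_(h1, h2 <- Delta Q h)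
         g ⊗ h1 ⊗ h2 ⊗ a)
    * (\tsum_(a, b, c <- Phi Q) a ⊗ b ⊗ c ⊗ 1) =
    (\tsum_(g, h, a <- Phi_lambda) g ⊗ h ⊗ lambda a)
    * (\tsum_(g, h, a <- Phi_lambda) \tsum_(g1, g2 <- Delta Q g)
         g1 ⊗ g2 ⊗ h ⊗ a);
  lambda_counit : forall u : A, (\tsum_(h, a <- lambda u) eps Q h *: a) = u;
  Phi_lambda_counit2 :
    (\tsum_(g, h, a <- Phi_lambda) eps Q h *: (g ⊗ a)) = 1 ⊗ 1;
  Phi_lambda_counit1 :
    (\tsum_(g, h, a <- Phi_lambda) eps Q g *: (h ⊗ a)) = 1 ⊗ 1
}.

Record bicomoduleAlgebra (k : fieldType) (H : algType k)
    (Q : quasiBialgebra H) (A : algType k) := BicomoduleAlgebra {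
  left_comodule :> leftComoduleAlgebra Q A;
  right_comodule :> rightComoduleAlgebra Q A;
  Phi_lr : H ⊗ A ⊗ H;
  PhiV_lr : H ⊗ A ⊗ H;
  mulPhiV_lr : Phi_lr * PhiV_lr = 1;
  mulVPhi_lr : PhiV_lr * Phi_lr = 1;
  lr_compat : forall u : A,
    Phi_lr
    * (\tsum_(a, h <- rho right_comodule u)
         \tsum_(g, b <- lambda left_comodule a) g ⊗ b ⊗ h) =
    (\tsum_(g, a <- lambda left_comodule u) g ⊗ rho right_comodule a) * Phi_lr;
  lr_cocycle_left :
    (1 ⊗ Phi_lr)
    * (\tsum_(g, a, h <- Phi_lr) \tsum_(l, b <- lambda left_comodule a)
         g ⊗ l ⊗ b ⊗ h)
    * (\tsum_(g, h, a <- Phi_lambda left_comodule) g ⊗ h ⊗ a ⊗ 1) =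
    (\tsum_(g, h, a <- Phi_lambda left_comodule)
       g ⊗ h ⊗ rho right_comodule a)
    * (\tsum_(g, a, h <- Phi_lr) \tsum_(g1, g2 <- Delta Q g)
         g1 ⊗ g2 ⊗ a ⊗ h);
  lr_cocycle_right :
    (1 ⊗ Phi_rho right_comodule)
    * (\tsum_(g, a, h <- Phi_lr) \tsum_(b, l <- rho right_comodule a)
         g ⊗ b ⊗ l ⊗ h)
    * (\tsum_(g, a, h <- Phi_lr) g ⊗ a ⊗ h ⊗ 1) =
    (\tsum_(g, a, h <- Phi_lr) g ⊗ a ⊗ Delta Q h)
    * (\tsum_(a, g, h <- Phi_rho right_comodule)
         \tsum_(l, b <- lambda left_comodule a) l ⊗ b ⊗ g ⊗ h)
}.

Section DiagonalCrossedProduct.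
Variables (k : fieldType) (H : algType k) (Q : quasiHopf H).
Variables (AA : lmodType k) (M : bimoduleAlgebra Q AA).
Variables (A : algType k) (C : bicomoduleAlgebra Q A).

Definition p_rho : A ⊗ H :=
  \tsum_(x1, x2, x3 <- PhiV_rho C) x1 ⊗ (x2 * beta Q * S Q x3).

Definition q_rho : A ⊗ H :=
  \tsum_(X1, X2, X3 <- Phi_rho C) X1 ⊗ (SV Q (alpha Q * X3) * X2).

Definition Omega : H ⊗ H ⊗ A ⊗ H ⊗ H :=
  \tsum_(X1, X2, X3 <- Phi_rho C)
  \tsum_(x1, x2, x3 <- PhiV_lambda C)
  \tsum_(t1, t2, t3 <- PhiV_lr C)
  \tsum_(f1, f2 <- twist_f Q)
  \tsum_(X1m, X10 <- lambda C X1)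
  \tsum_(X1m1, X1m2 <- Delta Q X1m)
  \tsum_(t2m, t20 <- lambda C t2)
    (X1m1 * x1 * t1) ⊗ (X1m2 * x2 * t2m) ⊗ (X10 * x3 * t20)
      ⊗ SV Q (f1 * X2 * t3) ⊗ SV Q (f2 * X3).

(* The underlying space of the diagonal crossed product is AA ⊗ A; only its
   linear structure, [dcp_one] and [dcp_mul] matter here (not the componentwise
   product of a tensor product of algebras, AA being nonassociative). *)
Definition dcp : lmodType k := (AA ⊗ A)%type.

Definition dcp_one : dcp := bone M ⊗ 1.

Definition dcp_mul (x y : dcp) : dcp :=
  \tsum_(phi, u <- x) \tsum_(phi', u' <- y)
  \tsum_(O1, O2, O3, O4, O5 <- Omega)
  \tsum_(u0, u1 <- rho C u) \tsum_(u0m, u00 <- lambda C u0)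
    bmul M (biact M O1 phi O5)
           (biact M (O2 * u0m) phi' (SV Q u1 * O4))
      ⊗ (O3 * u00 * u').

Definition dcp_Gamma (phi : AA) : dcp :=
  \tsum_(p1, p2 <- p_rho) \tsum_(p1m, p10 <- lambda C p1)
    biact M p1m phi (SV Q p2) ⊗ p10.

Definition dcp_j (u : A) : dcp := bone M ⊗ u.

Definition dcp_alg_map (B : algType k) (w : dcp -> B) : Prop :=
  [/\ linear w, w dcp_one = 1 & forall x y, w (dcp_mul x y) = w x * w y].

End DiagonalCrossedProduct.

(* Main.v *)
Require Import Defs.
From HB Require Import structures.
From mathcomp Require Import all_boot all_order all_algebra.
From mathcomp Require Import ring.
From mathcomp Require boolp.

Set Implicit Arguments.
Unset Strict Implicit.
Unset Printing Implicit Defensive.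

Import GRing.Theory.
Local Open Scope ring_scope.

(* The candidate w(phi ⊗ u) = gamma(q^1) v(phi . q^2) gamma(u), with q = q_rho, is
   forced because phi ⊗ u = j(q^1) (Gamma(phi . q^2) j(u)), which comes down to
   q^1_<0> p^1 ⊗ q^1_<1> p^2 S(q^2) = 1 ⊗ 1.  Multiplicativity: expand
   v of a product by the second hypothesis on v, move every u_[-1] inside v across
   to the left with the first one, and simplify with the cocycle identities.  The
   elements Phi_lambda cancel, and what remains is governed by
     (q ⊗ 1) (rho ⊗ id)(q) Phi_rho^-1 =
       [1 ⊗ S^-1(f^2 X^3) ⊗ S^-1(f^1 X^2)] (id ⊗ Delta)(q rho(X^1)),
   X = Phi_rho.  The twist f enters only through
   f Delta(S(h)) = (S ⊗ S)(Delta^cop(h)) f and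
   f Delta(alpha) = S(A^2) alpha A^3 ⊗ S(A^1) alpha A^4; its invertibility is
   not needed.

   Identities in iterated tensor products are stated after applying an arbitrary
   multilinear map F, i.e. as equalities of iterated Sweedler sums. *)

(** * Multilinear maps and Sweedler sums *)

Section Lin.
Variable k : fieldType.
Implicit Types U V W X Y Z : lmodType k.

(** Convertible to [linear]; as a plain predicate on functions it can be matched syntactically by
    the tactic [multilin]. *)
Definition lin U V (f : U -> V) : Prop :=
  forall c x y, f (c *: x + y) = c *: f x + f y.

Lemma lin_id U : lin (fun x : U => x).
Proof. by []. Qed.

Lemma lin_comp U V W (g : V -> W) (f : U -> V) :
  lin g -> lin f -> lin (fun x => g (f x)).
Proof. by move=> lg lf c x y; rewrite lf lg. Qed.

Lemma linD U V (f : U -> V) x y : lin f -> f (x + y) = f x + f y.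
Proof. by move=> lf; rewrite -[x in LHS]scale1r lf scale1r. Qed.

Lemma lin0 U V (f : U -> V) : lin f -> f 0 = 0.
Proof. by move=> lf; apply: (addrI (f 0)); rewrite -linD// !addr0. Qed.

Lemma linZ U V (f : U -> V) c x : lin f -> f (c *: x) = c *: f x.
Proof. by move=> lf; rewrite -[c *: x]addr0 lf (lin0 lf) addr0. Qed.

Lemma lin_sum U V (f : U -> V) I (r : seq I) (F : I -> U) :
  lin f -> f (\sum_(i <- r) F i) = \sum_(i <- r) f (F i).
Proof.
move=> lf; elim: r => [|i r IH]; first by rewrite !big_nil lin0.
by rewrite !big_cons linD// IH.
Qed.

Lemma lin_linear U V X (f : {linear U -> V}) (E : X -> U) :
  lin E -> lin (fun x => f (E x)).
Proof. by move=> lE c x y; rewrite lE linearP. Qed.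

Lemma lin_scale U V (E : U -> V) a : lin E -> lin (fun x => a *: E x).
Proof. by move=> lE c x y; rewrite lE scalerDr !scalerA mulrC. Qed.

Lemma lin_scalar (H : algType k) U V (e : {lrmorphism H -> k | *%R})
    (E : U -> H) (w : V) : lin E -> lin (fun x => e (E x) *: w).
Proof. by move=> lE c x y; rewrite lE linearP scalerDl scalerA. Qed.

Lemma lin_mull U (R : algType k) (E : U -> R) a :
  lin E -> lin (fun x => E x * a).
Proof. by move=> lE c x y; rewrite lE mulrDl scalerAl. Qed.

Lemma lin_mulr U (R : algType k) (E : U -> R) a :
  lin E -> lin (fun x => a * E x).
Proof. by move=> lE c x y; rewrite lE mulrDr scalerAr. Qed.

Lemma bilinP U V W (f : U -> V -> W) :
  (forall v, lin (fun u => f u v)) -> (forall u, lin (f u)) -> bilin f.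
Proof. by []. Qed.

Lemma lin_bil1 U V W X (f : U -> V -> W) (E : X -> U) b :
  bilin f -> lin E -> lin (fun x => f (E x) b).
Proof. by move=> [fl _] lE c x y; rewrite lE; apply: (fl b). Qed.

Lemma lin_bil2 U V W X (f : U -> V -> W) (E : X -> V) a :
  bilin f -> lin E -> lin (fun x => f a (E x)).
Proof. by move=> [_ fr] lE c x y; rewrite lE; apply: (fr a). Qed.

Lemma lin_tsum_in X U V W (E : X -> U ⊗ V) (F : U -> V -> W) :
  bilin F -> lin E -> lin (fun x => tsum (E x) F).
Proof. by move=> bF lE c x y; rewrite lE tsum_linear. Qed.

(** The sum runs over a fixed representative of [t], so linearity in the parameter is checked term
    by term. *)
Lemma lin_tsum_out X U V W (t : U ⊗ V) (F : X -> U -> V -> W) :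
  (forall a b, lin (fun x => F x a b)) -> lin (fun x => tsum t (F x)).
Proof.
move=> lF c x y; rewrite /tsum scaler_sumr -big_split.
by apply: eq_bigr => p _; rewrite lF.
Qed.

Definition trilin U V X W (F : U -> V -> X -> W) : Prop :=
  [/\ forall b c, lin (fun a => F a b c), forall a c, lin (fun b => F a b c)
    & forall a b, lin (F a b)].

Lemma lin_tri1 Y U V X W (F : U -> V -> X -> W) (E : Y -> U) b c :
  trilin F -> lin E -> lin (fun x => F (E x) b c).
Proof. by case=> F1 _ _ lE; apply: (lin_comp (F1 b c)). Qed.

Lemma lin_tri2 Y U V X W (F : U -> V -> X -> W) (E : Y -> V) a c :
  trilin F -> lin E -> lin (fun x => F a (E x) c).
Proof. by case=> _ F2 _ lE; apply: (lin_comp (F2 a c)). Qed.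

Lemma lin_tri3 Y U V X W (F : U -> V -> X -> W) (E : Y -> X) a b :
  trilin F -> lin E -> lin (fun x => F a b (E x)).
Proof. by case=> _ _ F3 lE; apply: (lin_comp (F3 a b)). Qed.

Definition quadlin U V X Y W (F : U -> V -> X -> Y -> W) : Prop :=
  [/\ forall b c d, lin (fun a => F a b c d),
      forall a c d, lin (fun b => F a b c d),
      forall a b d, lin (fun c => F a b c d)
    & forall a b c, lin (F a b c)].

Lemma lin_quad1 Z U V X Y W (F : U -> V -> X -> Y -> W) (E : Z -> U) b c d :
  quadlin F -> lin E -> lin (fun x => F (E x) b c d).
Proof. by case=> F1 _ _ _ lE; apply: (lin_comp (F1 b c d)). Qed.

Lemma lin_quad2 Z U V X Y W (F : U -> V -> X -> Y -> W) (E : Z -> V) a c d :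
  quadlin F -> lin E -> lin (fun x => F a (E x) c d).
Proof. by case=> _ F2 _ _ lE; apply: (lin_comp (F2 a c d)). Qed.

Lemma lin_quad3 Z U V X Y W (F : U -> V -> X -> Y -> W) (E : Z -> X) a b d :
  quadlin F -> lin E -> lin (fun x => F a b (E x) d).
Proof. by case=> _ _ F3 _ lE; apply: (lin_comp (F3 a b d)). Qed.

Lemma lin_quad4 Z U V X Y W (F : U -> V -> X -> Y -> W) (E : Z -> Y) a b c :
  quadlin F -> lin E -> lin (fun x => F a b c (E x)).
Proof. by case=> _ _ _ F4 lE; apply: (lin_comp (F4 a b c)). Qed.

End Lin.

Lemma biactE (k : fieldType) (H : algType k) (Q : quasiBialgebra H)
  (AA : lmodType k) (M : bimoduleAlgebra Q AA) g phi h :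
  biact M g phi h = ract M (lact M g phi) h.
Proof. by []. Qed.

Section TsumRules.
Variable k : fieldType.
Implicit Types U V W X Y Z : lmodType k.

Lemma eq_tsum U V (W : nmodType) (t : U ⊗ V) (F G : U -> V -> W) :
  (forall a b, F a b = G a b) -> tsum t F = tsum t G.
Proof. by move=> FG; apply: eq_bigr. Qed.

(** Both sums run over fixed representatives, hence they are ordinary finite sums and may be
    exchanged. *)
Lemma tsum_pull U V X Y (W : nmodType) (x : U ⊗ V) (t : X ⊗ Y)
    (F : U -> V -> W) (G : U -> V -> X -> Y -> W) :
  (forall a b, F a b = tsum t (G a b)) ->
  tsum x F = tsum t (fun c d => tsum x (fun a b => G a b c d)).
Proof. by move=> FG; rewrite (eq_tsum _ FG) /tsum exchange_big. Qed.

Lemma tsum_lin U V W X (K : W -> X) (t : U ⊗ V) (F : U -> V -> W) :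
  lin K -> K (tsum t F) = tsum t (fun a b => K (F a b)).
Proof. by move=> lK; rewrite /tsum lin_sum. Qed.

Lemma tsum_tsum U V X Y W (x : U ⊗ V) (G : U -> V -> X ⊗ Y) (F : X -> Y -> W) :
  bilin F -> tsum (tsum x G) F = tsum x (fun a b => tsum (G a b) F).
Proof.
by move=> bF; apply: (tsum_lin (K := fun t => tsum t F)); exact: tsum_linear.
Qed.

Lemma tsumM (A B : algType k) W (x y : A ⊗ B) (F : A -> B -> W) :
  bilin F ->
  tsum (x * y) F = tsum x (fun a b => tsum y (fun c d => F (a * c) (b * d))).
Proof.
move=> bF; rewrite /GRing.mul /= /tensor_mul tsum_tsum//.
by apply: eq_tsum => a b; rewrite tsum_tsum//; apply: eq_tsum => c d; rewrite tsum_tens.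
Qed.

Lemma tsum1 (A B : algType k) W (F : A -> B -> W) :
  bilin F -> tsum 1 F = F 1 1.
Proof. by move=> bF; rewrite -tens11 tsum_tens. Qed.

Lemma tsumMmorph (R A B : algType k) (f : {lrmorphism R -> A ⊗ B}) W x y
    (F : A -> B -> W) :
  bilin F -> tsum (f (x * y)) F =
    tsum (f x) (fun a b => tsum (f y) (fun c d => F (a * c) (b * d))).
Proof. by move=> bF; rewrite rmorphM tsumM. Qed.

Lemma tsum1morph (R A B : algType k) (f : {lrmorphism R -> A ⊗ B}) W
    (F : A -> B -> W) : bilin F -> tsum (f 1) F = F 1 1.
Proof. by move=> bF; rewrite rmorph1 tsum1. Qed.

Lemma tsum_Z U V W c (x : U ⊗ V) (F : U -> V -> W) :
  bilin F -> tsum (c *: x) F = c *: tsum x F.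
Proof. by move=> bF; apply: (linZ (f := fun t => tsum t F)); exact: tsum_linear. Qed.

End TsumRules.

Lemma epsM (k : fieldType) (H : algType k) (Q : quasiBialgebra H) (a b : H) :
  eps Q (a * b) = eps Q a * eps Q b.
Proof. exact: rmorphM. Qed.

Lemma epsZ (k : fieldType) (H : algType k) (Q : quasiBialgebra H) c (a : H) :
  eps Q (c *: a) = c * eps Q a.
Proof. exact: linearZ. Qed.

Lemma eps1 (k : fieldType) (H : algType k) (Q : quasiBialgebra H) : eps Q 1 = 1.
Proof. exact: rmorph1. Qed.

Section SVlin.
Variables (k : fieldType) (H : algType k) (Q : quasiHopf H).

(** The map [SV] is given only as the inverse of [S]; its algebraic properties are obtained by
    applying the injective map [S] to both sides. *)
Lemma SV_lin : lin (SV Q).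
Proof. by move=> c x y; apply: (can_inj (@S_bijl _ _ Q)); rewrite linearP !S_bijr. Qed.

Lemma SV_mul (a b : H) : SV Q (a * b) = SV Q b * SV Q a.
Proof. by apply: (can_inj (@S_bijl _ _ Q)); rewrite S_mul !S_bijr. Qed.

Lemma SV_one : SV Q 1 = 1.
Proof. by apply: (can_inj (@S_bijl _ _ Q)); rewrite S_bijr S_one. Qed.

Lemma eps_SV h : eps Q (SV Q h) = eps Q h.
Proof. by rewrite -[in RHS](S_bijr Q h) eps_S. Qed.

End SVlin.

(** * Tactics for multilinearity and for iterated Sweedler sums *)

Ltac multilin :=
  cbv beta;
  lazymatch goal with
  | |- bilin (@tens _ _ _) => exact: tens_bilin
  | |- bilin (@lact _ _ _ _ _) => exact: lact_bilin
  | |- bilin (@ract _ _ _ _ _) => exact: ract_bilin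
  | |- bilin (@bmul _ _ _ _ _) => exact: bmul_bilin
  | |- bilin (fun a b => _) => apply: bilinP => ?; multilin
  | |- bilin _ => first [assumption | apply: bilinP => ?; multilin]
  | |- trilin (fun a b c => _) => split=> ? ?; multilin
  | |- quadlin (fun a b c d => _) => split=> ? ? ?; multilin
  | |- trilin _ => first [assumption | split=> ? ?; multilin]
  | |- quadlin _ => first [assumption | split=> ? ? ?; multilin]
  | |- _ => multilin_step
  end
with multilin_step :=
  match goal with
  | |- lin _ => assumption
  | |- lin (fun x => x) => exact: lin_id
  | |- lin (fun x => tsum ?t (@?F x)) => apply: lin_tsum_out => ? ?; multilin
  | |- lin (fun x => tsum (@?E x) ?F) => apply: (lin_tsum_in (E := E)); multilin
  | |- lin (fun x => ?a * (@?E x)) => apply: (lin_mulr (E := E)); multilin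
  | |- lin (fun x => (@?E x) * ?a) => apply: (lin_mull (E := E)); multilin
  | |- lin (fun x => ?a *: (@?E x)) => apply: (lin_scale (E := E)); multilin
  | |- lin (fun x => _ *: ?a) => apply: lin_scalar; multilin
  | |- lin (fun x => SV ?Q (@?E x)) =>
      apply: (lin_comp (f := E) (SV_lin Q)); multilin
  | |- lin (fun x => biact _ _ _ _) => rewrite /biact; multilin
  | |- lin (fun x => tens (@?E x) ?b) =>
      apply: (lin_bil1 (E := E) b (@tens_bilin _ _ _)); multilin
  | |- lin (fun x => tens ?b (@?E x)) =>
      apply: (lin_bil2 (E := E) b (@tens_bilin _ _ _)); multilin
  | |- lin (fun x => lact ?M (@?E x) ?b) =>
      apply: (lin_bil1 (E := E) b (lact_bilin M)); multilin
  | |- lin (fun x => lact ?M ?b (@?E x)) =>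
      apply: (lin_bil2 (E := E) b (lact_bilin M)); multilin
  | |- lin (fun x => ract ?M (@?E x) ?b) =>
      apply: (lin_bil1 (E := E) b (ract_bilin M)); multilin
  | |- lin (fun x => ract ?M ?b (@?E x)) =>
      apply: (lin_bil2 (E := E) b (ract_bilin M)); multilin
  | |- lin (fun x => bmul ?M (@?E x) ?b) =>
      apply: (lin_bil1 (E := E) b (bmul_bilin M)); multilin
  | |- lin (fun x => bmul ?M ?b (@?E x)) =>
      apply: (lin_bil2 (E := E) b (bmul_bilin M)); multilin
  | h : quadlin ?F |- lin (fun x => ?F (@?E x) ?b ?c ?d) =>
      apply: (lin_quad1 (E := E) b c d h); multilin
  | h : quadlin ?F |- lin (fun x => ?F ?b (@?E x) ?c ?d) =>
      apply: (lin_quad2 (E := E) b c d h); multilin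
  | h : quadlin ?F |- lin (fun x => ?F ?b ?c (@?E x) ?d) =>
      apply: (lin_quad3 (E := E) b c d h); multilin
  | h : quadlin ?F |- lin (fun x => ?F ?b ?c ?d (@?E x)) =>
      apply: (lin_quad4 (E := E) b c d h); multilin
  | h : quadlin ?F |- lin (?F ?b ?c ?d) => case: h => _ _ _; exact
  | h : trilin ?F |- lin (fun x => ?F (@?E x) ?b ?c) =>
      apply: (lin_tri1 (E := E) b c h); multilin
  | h : trilin ?F |- lin (fun x => ?F ?b (@?E x) ?c) =>
      apply: (lin_tri2 (E := E) b c h); multilin
  | h : trilin ?F |- lin (fun x => ?F ?b ?c (@?E x)) =>
      apply: (lin_tri3 (E := E) b c h); multilin
  | h : trilin ?F |- lin (?F ?b ?c) => case: h => _ _; exact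
  | h : bilin ?F |- lin (fun x => ?F (@?E x) ?b) =>
      apply: (lin_bil1 (E := E) b h); multilin
  | h : bilin ?F |- lin (fun x => ?F ?b (@?E x)) =>
      apply: (lin_bil2 (E := E) b h); multilin
  | h : bilin ?F |- lin (?F ?b) => case: h => _; exact
  | h : forall y, lin (?F y) |- lin (?F _) => exact: h
  | h : lin ?F |- lin (fun x => ?F (@?E x)) =>
      apply: (lin_comp (f := E) h); multilin
  | |- lin (fun x => ?f (@?E x)) => apply: (lin_linear _ (E := E)); multilin
  | |- lin (GRing.mul ?a) => apply: (lin_mulr (E := id)); exact: lin_id
  | |- lin ?f => exact: (lin_linear _ (@lin_id _ _))
  end.

(* On a goal [L = ?R], rewrites L into iterated sums over elements that are neither
   products nor sums, followed by scalars, followed by a sum-free body.  The pattern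
   [?f (_)] also matches structure maps such as Delta, rho and lambda. *)
Ltac sweedler_expand :=
  cbv beta;
  lazymatch goal with
  | |- tsum ?t ?F = _ =>
    lazymatch t with
    | tens _ _ => etransitivity; [apply: tsum_tens; multilin | sweedler_expand]
    | _ * _ => etransitivity; [apply: tsumM; multilin | sweedler_expand]
    | tsum _ _ => etransitivity; [apply: tsum_tsum; multilin | sweedler_expand]
    | 1 => etransitivity; [apply: tsum1; multilin | sweedler_expand]
    | _ *: _ => etransitivity; [apply: tsum_Z; multilin | sweedler_expand]
    | _ (_ * _) => etransitivity; [apply: tsumMmorph; multilin | sweedler_expand]
    | _ 1 => etransitivity; [apply: tsum1morph; multilin | sweedler_expand]
    | ?f (?c *: ?y) =>
      etransitivity;
        [apply: (@linZ _ _ _ (fun z => tsum (f z) F) c y); multilin | sweedler_expand]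
    | ?f (tsum ?s ?G) =>
      etransitivity;
        [apply: (@tsum_lin _ _ _ _ _ (fun z => tsum (f z) F) s G); multilin
        | sweedler_expand]
    | _ => apply: eq_tsum; intros; sweedler_expand
    end
  | |- ?L = _ =>
    lazymatch L with
    | context [tsum _ _] =>
      match L with context C [tsum ?t ?F] =>
      let K := constr:(fun z => ltac:(let r := context C[z] in exact r)) in
      etransitivity; [apply: (@tsum_lin _ _ _ _ _ K t F); multilin | sweedler_expand]
      end
    | _ => pull_scalars
    end
  end
with pull_scalars :=
  cbv beta;
  lazymatch goal with
  | |- ?c *: ?y = _ => apply: (congr1 (fun z => c *: z)); pull_scalars
  | |- ?L = _ =>
    lazymatch L with
    | context [_ *: _] =>
      match L with context C [?c *: ?y] =>
      let K := constr:(fun z => ltac:(let r := context C[z] in exact r)) in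
      etransitivity; [apply: (@linZ _ _ _ K c y); multilin | pull_scalars]
      end
    | _ => reflexivity
    end
  end.

(* Moves a sum over t to the front.  The branching [+] lets the caller backtrack to
   a later sum when several of them range over the same t. *)
Ltac pull_sum t :=
  cbv beta;
  lazymatch goal with
  | |- tsum t _ = _ => reflexivity + (eapply tsum_pull; intros; pull_sum t)
  | |- tsum _ _ = _ => eapply tsum_pull; intros; pull_sum t
  end.

(** Aligns the sums on the left with those on the right from the outside in, then runs [tac] on the
    bodies. *)
Ltac reorder_sums tac :=
  cbv beta;
  lazymatch goal with
  | |- _ = tsum ?t _ =>
     etransitivity; [pull_sum t | eapply eq_tsum; intros; reorder_sums tac]
  | |- _ = _ => tac
  end.

Ltac sweedler_simpl :=
  rewrite ?biactE ?S_mul ?SV_mul ?S_bijl ?S_bijr ?mulr_tens ?S_one ?SV_one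
    ?epsZ ?epsM ?eps1 ?rmorphM ?rmorph1 ?eps_S ?eps_SV ?eps_alpha ?eps_beta
    ?lactM ?ractM ?lact_ract ?lact1 ?ract1 ?mulrA ?mul1r ?mulr1 ?scale1r.

Ltac sweedler_body :=
  first [reflexivity
        | by rewrite ?mulrA ?mul1r ?mulr1
        | by sweedler_simpl
        | solve [sweedler_simpl; rewrite ?scalerA; congr (_ *: _); ring]].

(* Proves an equality of two expressions whose expansions agree up to the order of
   the sums and the rules of sweedler_simpl. *)
Ltac sweedler :=
  etransitivity;
    [sweedler_expand
    | symmetry; etransitivity;
        [sweedler_expand | reorder_sums ltac:(sweedler_body)]].

Ltac sweedler_step e := transitivity e; [sweedler|].

(** Works at the outermost level at which [tac] succeeds and goes under one more sum otherwise. The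
    right-hand side of the goal is an existential variable, which [reflexivity] instantiates with
    the rewritten term. *)
Ltac under_sums tac :=
  cbv beta;
  lazymatch goal with
  | |- tsum _ _ = _ => first [tac; reflexivity | apply: eq_tsum; intros; under_sums tac]
  | |- _ => tac; reflexivity
  end.

Ltac rewrite_under lem := etransitivity; [under_sums ltac:(rewrite lem)|cbv beta].

(* Replaces the left-hand side of the goal, up to sweedler, along an identity whose
   last hypothesis is the multilinearity of the map it is evaluated at. *)
Tactic Notation "sweedler_with" constr(e) :=
  refine (etrans _ (etrans (e _) _)); [ | multilin | ]; cbv beta; [sweedler | ].

Lemma tsum4M (k : fieldType) (A B C D : algType k) (W : lmodType k)
    (F : A -> B -> C -> D -> W) (x y : A ⊗ B ⊗ C ⊗ D) : quadlin F ->
  (\tsum_(a, b, c, d <- x * y) F a b c d) =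
  \tsum_(a, b, c, d <- x) \tsum_(a', b', c', d' <- y)
     F (a * a') (b * b') (c * c') (d * d').
Proof.
by move=> qF; etransitivity; [apply: tsumM; multilin | sweedler].
Qed.

(** * Counit conditions for inverses *)

Section CounitInverse.
Variables (k : fieldType) (A B C : algType k).

(** A counit on one tensor leg is an algebra map. It sends [x] and [x * y] to 1, hence also [y]. The
    same argument serves the other two legs. *)
Lemma counit1_inv (e : {lrmorphism A -> k | *%R}) (x y : A ⊗ B ⊗ C) :
  x * y = 1 -> (\tsum_(a, b, c <- x) e a *: (b ⊗ c)) = 1 ⊗ 1 ->
  (\tsum_(a, b, c <- y) e a *: (b ⊗ c)) = 1 ⊗ 1.
Proof.
move=> xy ex; rewrite -[LHS]mul1r -{1}tens11 -ex.
sweedler_step (\tsum_(a, b, c <- x * y) e a *: (b ⊗ c)).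
by rewrite xy tsum1; last multilin; rewrite tsum1 ?rmorph1 ?scale1r //; multilin.
Qed.

Lemma counit2_inv (e : {lrmorphism B -> k | *%R}) (x y : A ⊗ B ⊗ C) :
  x * y = 1 -> (\tsum_(a, b, c <- x) e b *: (a ⊗ c)) = 1 ⊗ 1 ->
  (\tsum_(a, b, c <- y) e b *: (a ⊗ c)) = 1 ⊗ 1.
Proof.
move=> xy ex; rewrite -[LHS]mul1r -{1}tens11 -ex.
sweedler_step (\tsum_(a, b, c <- x * y) e b *: (a ⊗ c)).
by rewrite xy tsum1; last multilin; rewrite tsum1 ?rmorph1 ?scale1r //; multilin.
Qed.

Lemma counit3_inv (e : {lrmorphism C -> k | *%R}) (x y : A ⊗ B ⊗ C) :
  x * y = 1 -> (\tsum_(a, b, c <- x) e c *: (a ⊗ b)) = 1 ⊗ 1 ->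
  (\tsum_(a, b, c <- y) e c *: (a ⊗ b)) = 1 ⊗ 1.
Proof.
move=> xy ex; rewrite -[LHS]mul1r -{1}tens11 -ex.
sweedler_step (\tsum_(a, b, c <- x * y) e c *: (a ⊗ b)).
by rewrite xy tsum1; last multilin; rewrite tsum1 ?rmorph1 ?scale1r //; multilin.
Qed.

End CounitInverse.

Section SelfCoaction.
Variables (k : fieldType) (H : algType k) (Q : quasiBialgebra H).

Lemma self_quasi_coassoc (h : H) :
  Phi Q * (\tsum_(h1, h2 <- Delta Q h) \tsum_(a, b <- Delta Q h1) a ⊗ b ⊗ h2) =
  (\tsum_(h1, h2 <- Delta Q h) h1 ⊗ Delta Q h2) * Phi Q.
Proof. by rewrite quasi_coassoc -[RHS]mulrA mulVPhi mulr1. Qed.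

(** The regular coaction of [H] on itself through [Delta], with [Phi] in the role of [Phi_rho]; it
    makes [qp_rho] available for [Phi]. *)
Definition self_coaction : rightComoduleAlgebra Q H :=
  RightComoduleAlgebra (mulPhiV Q) (mulVPhi Q) self_quasi_coassoc
    (Phi_cocycle Q) (counitr Q) (Phi_counit2 Q) (Phi_counit3 Q).

End SelfCoaction.

(** * Right comodule algebras *)

Section RightComodule.
Variables (k : fieldType) (H : algType k) (Q : quasiBialgebra H).
Variables (A : algType k) (C : rightComoduleAlgebra Q A).

(** The cocycle axiom evaluated at a quadrilinear map. The variants below move invertible factors to
    the other side. *)
Lemma rho_cocycleE (W : lmodType k) (F : A -> H -> H -> H -> W) : quadlin F ->
  \tsum_(Y1, Y2, Y3 <- Phi Q) \tsum_(X1, X2, X3 <- Phi_rho C)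
  \tsum_(X21, X22 <- Delta Q X2) \tsum_(Z1, Z2, Z3 <- Phi_rho C)
    F (X1 * Z1) (Y1 * X21 * Z2) (Y2 * X22 * Z3) (Y3 * X3) =
  \tsum_(X1, X2, X3 <- Phi_rho C) \tsum_(X31, X32 <- Delta Q X3)
  \tsum_(Z1, Z2, Z3 <- Phi_rho C) \tsum_(Z10, Z11 <- rho C Z1)
    F (X1 * Z10) (X2 * Z11) (X31 * Z2) (X32 * Z3).
Proof.
move=> qF.
have e := congr1 (fun t => \tsum_(a, b, c, d <- t) F a b c d) (rho_cocycle C).
by etransitivity; [|etransitivity; [exact: e|]];
  (rewrite !tsum4M; [sweedler | multilin ..]).
Qed.

(* (id ⊗ Delta ⊗ id)(Phi_rho) (Phi_rho ⊗ 1) =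
   (1 ⊗ Phi^-1) (id ⊗ id ⊗ Delta)(Phi_rho) (rho ⊗ id ⊗ id)(Phi_rho) *)
Lemma rho_cocycleE_PhiV (W : lmodType k) (F : A -> H -> H -> H -> W) : quadlin F ->
  \tsum_(X1, X2, X3 <- Phi_rho C) \tsum_(X21, X22 <- Delta Q X2)
  \tsum_(Z1, Z2, Z3 <- Phi_rho C)
    F (X1 * Z1) (X21 * Z2) (X22 * Z3) X3 =
  \tsum_(y1, y2, y3 <- PhiV Q)
  \tsum_(X1, X2, X3 <- Phi_rho C) \tsum_(X31, X32 <- Delta Q X3)
  \tsum_(Z1, Z2, Z3 <- Phi_rho C) \tsum_(Z10, Z11 <- rho C Z1)
    F (X1 * Z10) (y1 * X2 * Z11) (y2 * X31 * Z2) (y3 * X32 * Z3).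
Proof.
move=> qF.
sweedler_step (\tsum_(t1, t2, t3 <- (1 : H ⊗ H ⊗ H)) \tsum_(X1, X2, X3 <- Phi_rho C)
  \tsum_(X21, X22 <- Delta Q X2) \tsum_(Z1, Z2, Z3 <- Phi_rho C)
    F (X1 * Z1) (t1 * X21 * Z2) (t2 * X22 * Z3) (t3 * X3)).
(* The inserted unit becomes [PhiV Q * Phi Q]: the factor [Phi] completes the left-hand side of the
   cocycle identity, and [PhiV] remains in front. *)
rewrite -(mulVPhi Q).
sweedler_with (@rho_cocycleE W (fun a b c d => \tsum_(y1, y2, y3 <- PhiV Q)
   F a (y1 * b) (y2 * c) (y3 * d))).
sweedler.
Qed.

(* (1 ⊗ Phi) (id ⊗ Delta ⊗ id)(Phi_rho) =
   (id ⊗ id ⊗ Delta)(Phi_rho) (rho ⊗ id ⊗ id)(Phi_rho) (Phi_rho^-1 ⊗ 1) *)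
Lemma rho_cocycleE_PhiV_rho (W : lmodType k) (F : A -> H -> H -> H -> W) :
  quadlin F ->
  \tsum_(Y1, Y2, Y3 <- Phi Q) \tsum_(X1, X2, X3 <- Phi_rho C)
  \tsum_(X21, X22 <- Delta Q X2) F X1 (Y1 * X21) (Y2 * X22) (Y3 * X3) =
  \tsum_(X1, X2, X3 <- Phi_rho C) \tsum_(X31, X32 <- Delta Q X3)
  \tsum_(Z1, Z2, Z3 <- Phi_rho C) \tsum_(Z10, Z11 <- rho C Z1)
  \tsum_(y1, y2, y3 <- PhiV_rho C)
    F (X1 * Z10 * y1) (X2 * Z11 * y2) (X31 * Z2 * y3) (X32 * Z3).
Proof.
move=> qF.
sweedler_step (\tsum_(Y1, Y2, Y3 <- Phi Q) \tsum_(X1, X2, X3 <- Phi_rho C)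
  \tsum_(X21, X22 <- Delta Q X2) \tsum_(t1, t2, t3 <- (1 : A ⊗ H ⊗ H))
   F (X1 * t1) (Y1 * X21 * t2) (Y2 * X22 * t3) (Y3 * X3)).
rewrite -(mulPhiV_rho C).
sweedler_with (@rho_cocycleE W (fun a b c d => \tsum_(y1, y2, y3 <- PhiV_rho C)
   F (a * y1) (b * y2) (c * y3) d)).
sweedler.
Qed.

(* (rho ⊗ id ⊗ id)(Phi_rho) (Phi_rho^-1 ⊗ 1) =
   (id ⊗ id ⊗ Delta)(Phi_rho^-1) (1 ⊗ Phi) (id ⊗ Delta ⊗ id)(Phi_rho) *)
Lemma rho_cocycleE_rho (W : lmodType k) (F : A -> H -> H -> H -> W) :
  quadlin F ->
  \tsum_(X1, X2, X3 <- Phi_rho C) \tsum_(X10, X11 <- rho C X1)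
  \tsum_(y1, y2, y3 <- PhiV_rho C) F (X10 * y1) (X11 * y2) (X2 * y3) X3 =
  \tsum_(y1, y2, y3 <- PhiV_rho C) \tsum_(y31, y32 <- Delta Q y3)
  \tsum_(Y1, Y2, Y3 <- Phi Q) \tsum_(X1, X2, X3 <- Phi_rho C)
  \tsum_(X21, X22 <- Delta Q X2)
    F (y1 * X1) (y2 * Y1 * X21) (y31 * Y2 * X22) (y32 * Y3 * X3).
Proof.
move=> qF; apply: esym.
sweedler_with (@rho_cocycleE_PhiV_rho W (fun a b c d =>
  \tsum_(y1, y2, y3 <- PhiV_rho C) \tsum_(y31, y32 <- Delta Q y3)
   F (y1 * a) (y2 * b) (y31 * c) (y32 * d))).
sweedler_step (\tsum_(t1, t2, t3 <- PhiV_rho C * Phi_rho C)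
  \tsum_(t31, t32 <- Delta Q t3)
  \tsum_(X1, X2, X3 <- Phi_rho C) \tsum_(X10, X11 <- rho C X1)
  \tsum_(y1, y2, y3 <- PhiV_rho C)
  F (t1 * X10 * y1) (t2 * X11 * y2) (t31 * X2 * y3) (t32 * X3)).
rewrite (mulVPhi_rho C); sweedler.
Qed.

(* (Phi_rho ⊗ 1) (rho ⊗ id ⊗ id)(Phi_rho^-1) =
   (id ⊗ Delta ⊗ id)(Phi_rho^-1) (1 ⊗ Phi^-1) (id ⊗ id ⊗ Delta)(Phi_rho) *)
Lemma rho_cocycleE_rhoV (W : lmodType k) (F : A -> H -> H -> H -> W) :
  quadlin F ->
  \tsum_(X1, X2, X3 <- Phi_rho C) \tsum_(y1, y2, y3 <- PhiV_rho C)
  \tsum_(y10, y11 <- rho C y1) F (X1 * y10) (X2 * y11) (X3 * y2) y3 =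
  \tsum_(y1, y2, y3 <- PhiV_rho C) \tsum_(y21, y22 <- Delta Q y2)
  \tsum_(z1, z2, z3 <- PhiV Q) \tsum_(X1, X2, X3 <- Phi_rho C)
  \tsum_(X31, X32 <- Delta Q X3)
    F (y1 * X1) (y21 * z1 * X2) (y22 * z2 * X31) (y3 * z3 * X32).
Proof.
move=> qF.
sweedler_step (\tsum_(t1, t2, t3 <- (1 : A ⊗ H ⊗ H)) \tsum_(t21, t22 <- Delta Q t2)
  \tsum_(X1, X2, X3 <- Phi_rho C) \tsum_(y1, y2, y3 <- PhiV_rho C)
  \tsum_(y10, y11 <- rho C y1)
    F (t1 * X1 * y10) (t21 * X2 * y11) (t22 * X3 * y2) (t3 * y3)).
rewrite -(mulVPhi_rho C).
sweedler_with (@rho_cocycleE_PhiV W (fun a b c d =>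
  \tsum_(y1, y2, y3 <- PhiV_rho C) \tsum_(y21, y22 <- Delta Q y2)
  \tsum_(x1, x2, x3 <- PhiV_rho C) \tsum_(x10, x11 <- rho C x1)
    F (y1 * a * x10) (y21 * b * x11) (y22 * c * x2) (y3 * d * x3))).
sweedler_step (\tsum_(y1, y2, y3 <- PhiV_rho C) \tsum_(y21, y22 <- Delta Q y2)
  \tsum_(z1, z2, z3 <- PhiV Q) \tsum_(X1, X2, X3 <- Phi_rho C)
  \tsum_(X31, X32 <- Delta Q X3)
  \tsum_(t1, t2, t3 <- Phi_rho C * PhiV_rho C) \tsum_(t10, t11 <- rho C t1)
    F (y1 * X1 * t10) (y21 * z1 * X2 * t11) (y22 * z2 * X31 * t2) (y3 * z3 * X32 * t3)).
rewrite (mulPhiV_rho C); sweedler.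
Qed.

End RightComodule.

(** * The antipode axioms under S^-1, and the elements [p_rho] and [q_rho] *)

Section Antipode.
Variables (k : fieldType) (H : algType k) (Q : quasiHopf H).

Lemma SV_antipode_alpha (h : H) :
  (\tsum_(h1, h2 <- Delta Q h) SV Q h2 * SV Q (alpha Q) * h1) =
  eps Q h *: SV Q (alpha Q).
Proof.
rewrite -(linZ (f := SV Q)); last exact: SV_lin.
rewrite -antipode_alpha (tsum_lin (K := SV Q)); last exact: SV_lin.
by apply: eq_tsum => a b; rewrite !SV_mul S_bijl mulrA.
Qed.

Lemma SV_antipode_beta (h : H) :
  (\tsum_(h1, h2 <- Delta Q h) h2 * SV Q (beta Q) * SV Q h1) =
  eps Q h *: SV Q (beta Q).
Proof.
rewrite -(linZ (f := SV Q)); last exact: SV_lin.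
rewrite -antipode_beta (tsum_lin (K := SV Q)); last exact: SV_lin.
by apply: eq_tsum => a b; rewrite !SV_mul S_bijl mulrA.
Qed.

Lemma SV_antipode_PhiV :
  (\tsum_(x1, x2, x3 <- PhiV Q)
     x3 * SV Q (beta Q) * SV Q x2 * SV Q (alpha Q) * x1) = 1.
Proof.
rewrite -[RHS](SV_one Q) -(antipode_PhiV Q) (tsum_lin (K := SV Q)); last exact: SV_lin.
apply: eq_tsum => a t; rewrite (tsum_lin (K := SV Q)); last exact: SV_lin.
by apply: eq_tsum => b c; rewrite !SV_mul !S_bijl !mulrA.
Qed.

End Antipode.

Section PQ.
Variables (k : fieldType) (H : algType k) (Q : quasiHopf H).
Variables (A : algType k) (C : rightComoduleAlgebra Q A).
Variables (W : lmodType k) (F : A -> H -> W) (bF : bilin F).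

Lemma PhiV_rho_counit3 :
  (\tsum_(a, g, h <- PhiV_rho C) eps Q h *: (a ⊗ g)) = 1 ⊗ 1.
Proof. exact: counit3_inv (mulPhiV_rho C) (Phi_rho_counit3 C). Qed.

Lemma PhiV_rho_counit2 :
  (\tsum_(a, g, h <- PhiV_rho C) eps Q g *: (a ⊗ h)) = 1 ⊗ 1.
Proof. exact: counit2_inv (mulPhiV_rho C) (Phi_rho_counit2 C). Qed.

(** In terms of p = [p_rho] and q = [q_rho] this is q^1_<0> p^1 ⊗ q^1_<1> p^2 S(q^2) = 1 ⊗ 1. After
    the cocycle identity, beta contracts Delta(X^2) and alpha contracts Delta(y^3). The counit
    conditions then remove Phi_rho and its inverse, and the antipode axiom for Phi is left. *)
Lemma qp_rho :
  \tsum_(X1, X2, X3 <- Phi_rho C) \tsum_(X10, X11 <- rho C X1)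
  \tsum_(y1, y2, y3 <- PhiV_rho C)
    F (X10 * y1) (X11 * y2 * beta Q * S Q y3 * S Q X2 * alpha Q * X3) = F 1 1.
Proof.
sweedler_with (@rho_cocycleE_rho _ _ _ _ C W (fun a b c d =>
  F a (b * beta Q * S Q c * alpha Q * d))).
sweedler_step (\tsum_(y1, y2, y3 <- PhiV_rho C) \tsum_(y31, y32 <- Delta Q y3)
  \tsum_(Y1, Y2, Y3 <- Phi Q) \tsum_(X1, X2, X3 <- Phi_rho C)
  F (y1 * X1) (y2 * Y1 * (\tsum_(g1, g2 <- Delta Q X2) g1 * beta Q * S Q g2)
     * S Q Y2 * S Q y31 * alpha Q * y32 * Y3 * X3)).
rewrite_under antipode_beta.
sweedler_step (\tsum_(y1, y2, y3 <- PhiV_rho C) \tsum_(y31, y32 <- Delta Q y3)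
  \tsum_(Y1, Y2, Y3 <- Phi Q)
  \tsum_(a, c <- \tsum_(a, g, h <- Phi_rho C) eps Q g *: (a ⊗ h))
  F (y1 * a) (y2 * Y1 * beta Q * S Q Y2 * S Q y31 * alpha Q * y32 * Y3 * c)).
rewrite_under (Phi_rho_counit2 C).
sweedler_step (\tsum_(y1, y2, y3 <- PhiV_rho C) \tsum_(Y1, Y2, Y3 <- Phi Q)
  F y1 (y2 * Y1 * beta Q * S Q Y2
    * (\tsum_(g1, g2 <- Delta Q y3) S Q g1 * alpha Q * g2) * Y3)).
rewrite_under antipode_alpha.
sweedler_step (\tsum_(a, b <- \tsum_(a, g, h <- PhiV_rho C) eps Q h *: (a ⊗ g))
  F a (b * (\tsum_(Y1, Y2, Y3 <- Phi Q) Y1 * beta Q * S Q Y2 * alpha Q * Y3))).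
rewrite PhiV_rho_counit3 antipode_Phi; sweedler.
Qed.

(** The companion identity q^1 p^1_<0> ⊗ S^-1(p^2) q^2 p^1_<1> = 1 ⊗ 1, which yields the value of w
    on Gamma. The contractions now use S^-1(beta) on Delta(X^3) and S^-1(alpha) on Delta(y^2), and
    end in the antipode axiom for Phi^-1. *)
Lemma pq_rho :
  \tsum_(X1, X2, X3 <- Phi_rho C) \tsum_(y1, y2, y3 <- PhiV_rho C)
  \tsum_(y10, y11 <- rho C y1)
    F (X1 * y10) (SV Q (alpha Q * X3 * y2 * beta Q * S Q y3) * X2 * y11) = F 1 1.
Proof.
sweedler_with (@rho_cocycleE_rhoV _ _ _ _ C W (fun a b c d =>
  F a (SV Q (alpha Q * c * beta Q * S Q d) * b))).
sweedler_step (\tsum_(y1, y2, y3 <- PhiV_rho C) \tsum_(y21, y22 <- Delta Q y2)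
  \tsum_(z1, z2, z3 <- PhiV Q) \tsum_(X1, X2, X3 <- Phi_rho C)
  F (y1 * X1) (y3 * z3
     * (\tsum_(g1, g2 <- Delta Q X3) g2 * SV Q (beta Q) * SV Q g1)
     * SV Q z2 * SV Q y22 * SV Q (alpha Q) * y21 * z1 * X2)).
rewrite_under SV_antipode_beta.
sweedler_step (\tsum_(y1, y2, y3 <- PhiV_rho C) \tsum_(y21, y22 <- Delta Q y2)
  \tsum_(z1, z2, z3 <- PhiV Q)
  \tsum_(a, b <- \tsum_(a, g, h <- Phi_rho C) eps Q h *: (a ⊗ g))
  F (y1 * a) (y3 * z3 * SV Q (beta Q)
     * SV Q z2 * SV Q y22 * SV Q (alpha Q) * y21 * z1 * b)).
rewrite_under (Phi_rho_counit3 C).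
sweedler_step (\tsum_(y1, y2, y3 <- PhiV_rho C) \tsum_(z1, z2, z3 <- PhiV Q)
  F y1 (y3 * z3 * SV Q (beta Q) * SV Q z2
    * (\tsum_(g1, g2 <- Delta Q y2) SV Q g2 * SV Q (alpha Q) * g1) * z1)).
rewrite_under SV_antipode_alpha.
sweedler_step (\tsum_(a, b <- \tsum_(a, g, h <- PhiV_rho C) eps Q g *: (a ⊗ h))
  F a (b * (\tsum_(z1, z2, z3 <- PhiV Q)
    z3 * SV Q (beta Q) * SV Q z2 * SV Q (alpha Q) * z1))).
rewrite PhiV_rho_counit2 SV_antipode_PhiV; sweedler.
Qed.
End PQ.

(** * The Drinfeld twist *)

Section Twist.
Variables (k : fieldType) (H : algType k) (Q : quasiHopf H).

(** Quasi-coassociativity multiplied by Phi^-1 on the left; it lets Phi^-1 pass an iterated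
    coproduct. *)
Lemma coassocVE (W : lmodType k) (F : H -> H -> H -> W) (h : H) : trilin F ->
  \tsum_(h1, h2 <- Delta Q h) \tsum_(a, b <- Delta Q h2) \tsum_(X, Y, Z <- PhiV Q)
     F (X * h1) (Y * a) (Z * b) =
  \tsum_(h1, h2 <- Delta Q h) \tsum_(a, b <- Delta Q h1) \tsum_(X, Y, Z <- PhiV Q)
     F (a * X) (b * Y) (h2 * Z).
Proof.
move=> tF.
have /(congr1 (fun t => (PhiV Q * t))) := quasi_coassoc Q h.
rewrite !mulrA mulVPhi mul1r.
move=> /(congr1 (fun t => \tsum_(a, b, c <- t) F a b c)) e.
by refine (etrans _ (etrans e _)); sweedler.
Qed.

(** Drinfeld's element S(A^2) alpha A^3 ⊗ S(A^1) alpha A^4, with A^1, ..., A^4 written out through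
    Phi and Phi^-1. Below it is called the gamma element. *)
Definition twist_gamma : H ⊗ H :=
  \tsum_(X1, X2, X3 <- Phi Q) \tsum_(x1, x2, x3 <- PhiV Q)
  \tsum_(x11, x12 <- Delta Q x1)
    (S Q (X2 * x12) * alpha Q * (X3 * x2)) ⊗ (S Q (X1 * x11) * alpha Q * x3).

Lemma twist_gammaE :
  (\tsum_(A1, A2, A3, A4 <- twist_A Q)
     (S Q A2 * alpha Q * A3) ⊗ (S Q A1 * alpha Q * A4)) = twist_gamma.
Proof.
rewrite /twist_A /twist_gamma tsum4M; last multilin.
sweedler.
Qed.

(** The gamma element plays for the coproduct the part that alpha plays for the identity map.
    Quasi-coassociativity moves the components of h past Phi^-1 and then past Phi, after which the
    two copies of alpha contract them, the inner pair first. *)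
Lemma twist_gamma_inv (W : lmodType k) (F : H -> H -> W) (h : H) : bilin F ->
  \tsum_(h1, h2 <- Delta Q h) \tsum_(h11, h12 <- Delta Q h1)
  \tsum_(g1, g2 <- twist_gamma) \tsum_(h21, h22 <- Delta Q h2)
    F (S Q h12 * g1 * h21) (S Q h11 * g2 * h22) =
  eps Q h *: \tsum_(g1, g2 <- twist_gamma) F g1 g2.
Proof.
move=> bF; rewrite /twist_gamma.
sweedler_with (fun tF => @coassocVE W (fun a b c => \tsum_(X1, X2, X3 <- Phi Q)
  \tsum_(a1, a2 <- Delta Q a)
     F (S Q (X2 * a2) * alpha Q * (X3 * b)) (S Q (X1 * a1) * alpha Q * c)) h tF).
sweedler_step (\tsum_(h1, h2 <- Delta Q h) \tsum_(x1, x2, x3 <- PhiV Q)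
  \tsum_(x11, x12 <- Delta Q x1)
  \tsum_(a, b, c <- Phi Q *
    (\tsum_(p, q <- Delta Q h1) \tsum_(r, s <- Delta Q p) r ⊗ s ⊗ q))
  F (S Q (b * x12) * alpha Q * (c * x2)) (S Q (a * x11) * alpha Q * (h2 * x3))).
rewrite_under (self_quasi_coassoc Q).
sweedler_step (\tsum_(h1, h2 <- Delta Q h) \tsum_(x1, x2, x3 <- PhiV Q)
  \tsum_(x11, x12 <- Delta Q x1) \tsum_(X1, X2, X3 <- Phi Q)
  \tsum_(p, q <- Delta Q h1)
  F (S Q (X2 * x12) * (\tsum_(q1, q2 <- Delta Q q) S Q q1 * alpha Q * q2) * (X3 * x2))
    (S Q (X1 * x11) * S Q p * alpha Q * (h2 * x3))).
rewrite_under antipode_alpha.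
sweedler_step (\tsum_(h1, h2 <- Delta Q h) \tsum_(x1, x2, x3 <- PhiV Q)
  \tsum_(x11, x12 <- Delta Q x1) \tsum_(X1, X2, X3 <- Phi Q)
  F (S Q (X2 * x12) * alpha Q * (X3 * x2))
    (S Q (X1 * x11) * S Q (\tsum_(p, q <- Delta Q h1) eps Q q *: p)
      * alpha Q * (h2 * x3))).
rewrite_under counitr.
sweedler_step (\tsum_(x1, x2, x3 <- PhiV Q)
  \tsum_(x11, x12 <- Delta Q x1) \tsum_(X1, X2, X3 <- Phi Q)
  F (S Q (X2 * x12) * alpha Q * (X3 * x2))
    (S Q (X1 * x11) * (\tsum_(h1, h2 <- Delta Q h) S Q h1 * alpha Q * h2) * x3)).
rewrite_under antipode_alpha.
sweedler.
Qed.

Section Invariant.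
Variables (W : lmodType k) (G : H -> H -> W) (bG : bilin G).
Hypothesis Ginv : forall h a b,
  \tsum_(h1, h2 <- Delta Q h) G (h1 * a) (h2 * b) = eps Q h *: G a b.

(** Write h = h_1 eps(h_2) and expand eps(h_2) beta by the antipode axiom. Moving Phi^-1 to the
    right then leaves a translation by Delta(h_1), absorbed by [Ginv], while h_2 enters the
    antipode. *)
Lemma inv_antipode (h : H) :
  \tsum_(x1, x2, x3 <- PhiV Q) G (x1 * h) (x2 * beta Q * S Q x3) =
  \tsum_(x1, x2, x3 <- PhiV Q) G x1 (x2 * beta Q * S Q (h * x3)).
Proof.
transitivity (\tsum_(x1, x2, x3 <- PhiV Q)
  G (x1 * (\tsum_(h1, h2 <- Delta Q h) eps Q h2 *: h1)) (x2 * beta Q * S Q x3)).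
  by rewrite counitr.
transitivity (\tsum_(x1, x2, x3 <- PhiV Q) \tsum_(h1, h2 <- Delta Q h)
  G (x1 * h1) (x2 * (eps Q h2 *: beta Q) * S Q x3)); first sweedler.
etransitivity; [under_sums ltac:(rewrite -antipode_beta)|].
sweedler_with (fun tF => @coassocVE W (fun a b c => G a (b * beta Q * S Q c)) h tF).
sweedler_step (\tsum_(h1, h2 <- Delta Q h) \tsum_(x1, x2, x3 <- PhiV Q)
  \tsum_(a, b <- Delta Q h1) G (a * x1) (b * (x2 * beta Q * S Q (h2 * x3)))).
rewrite_under Ginv.
sweedler_step (\tsum_(x1, x2, x3 <- PhiV Q) G x1 (x2 * beta Q * S Q x3 *
  S Q (\tsum_(h1, h2 <- Delta Q h) eps Q h1 *: h2))).
by rewrite counitl; sweedler.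
Qed.

(** The identity [qp_rho] for [H] over itself expresses G 1 1 with a translation by Delta(X^1). By
    [Ginv] it becomes eps(X^1), and the counit condition removes Phi. *)
Lemma inv_alpha :
  \tsum_(x1, x2, x3 <- PhiV Q) G x1 (x2 * beta Q * S Q x3 * alpha Q) = G 1 1.
Proof.
have /= <- := qp_rho (self_coaction Q) bG.
apply: esym.
sweedler_step (\tsum_(X1, X2, X3 <- Phi Q) \tsum_(y1, y2, y3 <- PhiV Q)
  \tsum_(a, b <- Delta Q X1)
  G (a * y1) (b * (y2 * beta Q * S Q y3 * S Q X2 * alpha Q * X3))).
rewrite_under Ginv.
sweedler_step (\tsum_(y1, y2, y3 <- PhiV Q)
  \tsum_(b, c <- \tsum_(X1, X2, X3 <- Phi Q) eps Q X1 *: (X2 ⊗ X3))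
  G y1 (y2 * beta Q * S Q y3 * S Q b * alpha Q * c)).
by rewrite_under (Phi_counit1 Q); sweedler.
Qed.

End Invariant.

(** The value of F at (S ⊗ S)(Delta^cop(a)) times the gamma element times Delta(b). The twist f
    corresponds to a ⊗ b = x^1 ⊗ x^2 beta S(x^3), so the two preceding lemmas apply to it once
    invariance is known. *)
Definition twist_form (W : lmodType k) (F : H -> H -> W) (a b : H) : W :=
  \tsum_(a1, a2 <- Delta Q a) \tsum_(g1, g2 <- twist_gamma)
  \tsum_(b1, b2 <- Delta Q b) F (S Q a2 * g1 * b1) (S Q a1 * g2 * b2).

Lemma twist_form_bilin (W : lmodType k) (F : H -> H -> W) :
  bilin F -> bilin (twist_form F).
Proof. by move=> bF; rewrite /twist_form; multilin. Qed.

(** As S reverses products, the components of h end up on both sides of the gamma element, where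
    [twist_gamma_inv] absorbs them. *)
Lemma twist_form_inv (W : lmodType k) (F : H -> H -> W) h a b : bilin F ->
  \tsum_(h1, h2 <- Delta Q h) twist_form F (h1 * a) (h2 * b) =
  eps Q h *: twist_form F a b.
Proof.
move=> bF; rewrite /twist_form.
sweedler_with (@twist_gamma_inv W (fun g1 g2 => \tsum_(a1, a2 <- Delta Q a)
  \tsum_(b1, b2 <- Delta Q b) F (S Q a2 * g1 * b1) (S Q a1 * g2 * b2)) h).
sweedler.
Qed.

Lemma twist_fE (W : lmodType k) (F : H -> H -> W) : bilin F ->
  \tsum_(f1, f2 <- twist_f Q) F f1 f2 =
  \tsum_(x1, x2, x3 <- PhiV Q) twist_form F x1 (x2 * beta Q * S Q x3).
Proof.
by move=> bF; rewrite /twist_f twist_gammaE /twist_form; sweedler.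
Qed.

(** Left multiplication of f by (S ⊗ S)(Delta^cop(h)) replaces x^1 by x^1 h; [inv_antipode] turns
    this into S(h x^3) = S(x^3) S(h), which is right multiplication by Delta(S(h)). *)
Lemma twist_f_S (W : lmodType k) (F : H -> H -> W) (h : H) : bilin F ->
  \tsum_(h1, h2 <- Delta Q h) \tsum_(f1, f2 <- twist_f Q)
    F (S Q h2 * f1) (S Q h1 * f2) =
  \tsum_(f1, f2 <- twist_f Q) \tsum_(g1, g2 <- Delta Q (S Q h))
    F (f1 * g1) (f2 * g2).
Proof.
move=> bF.
transitivity (\tsum_(x1, x2, x3 <- PhiV Q)
   twist_form F (x1 * h) (x2 * beta Q * S Q x3)).
  sweedler_step (\tsum_(f1, f2 <- twist_f Q) \tsum_(h1, h2 <- Delta Q h)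
    F (S Q h2 * f1) (S Q h1 * f2)).
  rewrite twist_fE; last multilin.
  by rewrite /twist_form; sweedler.
rewrite (inv_antipode (twist_form_bilin bF) (fun _ _ _ => twist_form_inv _ _ _ bF)).
rewrite twist_fE; last multilin.
rewrite_under S_mul; rewrite /twist_form; sweedler.
Qed.

(** Right multiplication by Delta(alpha) appends alpha to the second argument of [twist_form]; by
    [inv_alpha] the value is then the one at 1 and 1, the gamma element. *)
Lemma twist_f_alpha (W : lmodType k) (F : H -> H -> W) : bilin F ->
  \tsum_(f1, f2 <- twist_f Q) \tsum_(a1, a2 <- Delta Q (alpha Q))
    F (f1 * a1) (f2 * a2) = \tsum_(g1, g2 <- twist_gamma) F g1 g2.
Proof.
move=> bF; rewrite twist_fE; last multilin.
transitivity (\tsum_(x1, x2, x3 <- PhiV Q)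
   twist_form F x1 (x2 * beta Q * S Q x3 * alpha Q)).
  by rewrite /twist_form; sweedler.
rewrite (inv_alpha (twist_form_bilin bF) (fun _ _ _ => twist_form_inv _ _ _ bF)).
rewrite /twist_form; sweedler.
Qed.

End Twist.

(** * Counits of the twist, and the twist against S^-1 *)

Section TwistCounit.
Variables (k : fieldType) (H : algType k) (Q : quasiHopf H).

Lemma PhiV_counit2 :
  (\tsum_(a, b, c <- PhiV Q) eps Q b *: (a ⊗ c)) = 1 ⊗ 1.
Proof. exact: counit2_inv (mulPhiV Q) (Phi_counit2 Q). Qed.

Lemma PhiV_counit3 :
  (\tsum_(a, b, c <- PhiV Q) eps Q c *: (a ⊗ b)) = 1 ⊗ 1.
Proof. exact: counit3_inv (mulPhiV Q) (Phi_counit3 Q). Qed.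

Lemma twist_gamma_counit2 :
  (\tsum_(g1, g2 <- twist_gamma Q) eps Q g2 *: g1) = alpha Q.
Proof.
rewrite /twist_gamma.
sweedler_step (\tsum_(X1, X2, X3 <- Phi Q) \tsum_(x1, x2, x3 <- PhiV Q)
  eps Q X1 *: (eps Q x3 *: (S Q (X2 * \tsum_(a, b <- Delta Q x1) eps Q a *: b)
    * alpha Q * (X3 * x2)))).
rewrite_under counitl.
sweedler_step (\tsum_(X2, X3 <- \tsum_(X1, X2, X3 <- Phi Q) eps Q X1 *: (X2 ⊗ X3))
  \tsum_(x1, x2 <- \tsum_(x1, x2, x3 <- PhiV Q) eps Q x3 *: (x1 ⊗ x2))
  (S Q (X2 * x1) * alpha Q * (X3 * x2))).
by rewrite Phi_counit1 PhiV_counit3; sweedler.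
Qed.

Lemma twist_gamma_counit1 :
  (\tsum_(g1, g2 <- twist_gamma Q) eps Q g1 *: g2) = alpha Q.
Proof.
rewrite /twist_gamma.
sweedler_step (\tsum_(X1, X2, X3 <- Phi Q) \tsum_(x1, x2, x3 <- PhiV Q)
  eps Q X2 *: (eps Q X3 *: (eps Q x2 *:
  (S Q (X1 * \tsum_(a, b <- Delta Q x1) eps Q b *: a) * alpha Q * x3)))).
rewrite_under counitr.
sweedler_step (\tsum_(X1, X3 <- \tsum_(X1, X2, X3 <- Phi Q) eps Q X2 *: (X1 ⊗ X3))
  \tsum_(x1, x3 <- \tsum_(x1, x2, x3 <- PhiV Q) eps Q x2 *: (x1 ⊗ x3))
  eps Q X3 *: (S Q (X1 * x1) * alpha Q * x3)).
by rewrite Phi_counit2 PhiV_counit2; sweedler.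
Qed.

(** The counit turns the gamma element into alpha and removes the coproducts, leaving S(x^1) alpha
    x^2 beta S(x^3) = 1. *)
Lemma twist_f_counit2 : (\tsum_(f1, f2 <- twist_f Q) eps Q f2 *: f1) = 1.
Proof.
rewrite twist_fE; last multilin; rewrite /twist_form.
sweedler_step (\tsum_(x1, x2, x3 <- PhiV Q)
  S Q (\tsum_(a, b <- Delta Q x1) eps Q a *: b)
  * (\tsum_(g1, g2 <- twist_gamma Q) eps Q g2 *: g1)
  * (\tsum_(a, b <- Delta Q (x2 * beta Q * S Q x3)) eps Q b *: a)).
rewrite_under twist_gamma_counit2; rewrite_under counitl; rewrite_under counitr.
by rewrite -[RHS](antipode_PhiV Q); sweedler.
Qed.

Lemma twist_f_counit1 : (\tsum_(f1, f2 <- twist_f Q) eps Q f1 *: f2) = 1.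
Proof.
rewrite twist_fE; last multilin; rewrite /twist_form.
sweedler_step (\tsum_(x1, x2, x3 <- PhiV Q)
  S Q (\tsum_(a, b <- Delta Q x1) eps Q b *: a)
  * (\tsum_(g1, g2 <- twist_gamma Q) eps Q g1 *: g2)
  * (\tsum_(a, b <- Delta Q (x2 * beta Q * S Q x3)) eps Q a *: b)).
rewrite_under twist_gamma_counit1; rewrite_under counitr; rewrite_under counitl.
by rewrite -[RHS](antipode_PhiV Q); sweedler.
Qed.

(** Put h = S^-1(alpha c). The first twist identity replaces (S ⊗ S)(Delta^cop(h)) f by f
    Delta(alpha) Delta(c), and the second one replaces f Delta(alpha) by the gamma element.
    Everything is read through S^-1 with the legs exchanged. *)
Lemma twist_f_SV_alpha (c : H) :
  (\tsum_(f1, f2 <- twist_f Q) \tsum_(h1, h2 <- Delta Q (SV Q (alpha Q * c)))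
     (SV Q f2 * h1) ⊗ (SV Q f1 * h2)) =
  \tsum_(g1, g2 <- twist_gamma Q) \tsum_(c1, c2 <- Delta Q c)
     SV Q (g2 * c2) ⊗ SV Q (g1 * c1).
Proof.
sweedler_step (\tsum_(h1, h2 <- Delta Q (SV Q (alpha Q * c)))
  \tsum_(f1, f2 <- twist_f Q)
  SV Q (S Q h1 * f2) ⊗ SV Q (S Q h2 * f1)).
rewrite (@twist_f_S _ _ Q _ (fun a b => SV Q b ⊗ SV Q a)); last multilin.
rewrite S_bijr.
sweedler_with (@twist_f_alpha _ _ Q _ (fun a b => \tsum_(c1, c2 <- Delta Q c)
  SV Q (b * c2) ⊗ SV Q (a * c1))).
sweedler.
Qed.

End TwistCounit.

(** * Compatibility of [q_rho] with the twist *)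

Section QTwist.
Variables (k : fieldType) (H : algType k) (Q : quasiHopf H).
Variables (A : algType k) (C : rightComoduleAlgebra Q A).
Variables (W : lmodType k) (F : A -> H -> H -> W) (tF : trilin F).

Lemma q_rho_twist :
  \tsum_(Z1, Z2, Z3 <- Phi_rho C) \tsum_(X1, X2, X3 <- Phi_rho C)
  \tsum_(X10, X11 <- rho C X1) \tsum_(f1, f2 <- twist_f Q)
  \tsum_(m1, m2 <- Delta Q (SV Q (alpha Q * Z3) * Z2 * X11))
    F (Z1 * X10) (SV Q (f2 * X3) * m1) (SV Q (f1 * X2) * m2) =
  \tsum_(Z1, Z2, Z3 <- Phi_rho C) \tsum_(X1, X2, X3 <- Phi_rho C)
  \tsum_(X10, X11 <- rho C X1) \tsum_(y1, y2, y3 <- PhiV_rho C)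
    F (Z1 * X10 * y1) (SV Q (alpha Q * Z3) * Z2 * X11 * y2)
      (SV Q (alpha Q * X3) * X2 * y3).
Proof.
sweedler_step (\tsum_(Z1, Z2, Z3 <- Phi_rho C) \tsum_(X1, X2, X3 <- Phi_rho C)
  \tsum_(X10, X11 <- rho C X1) \tsum_(Z21, Z22 <- Delta Q Z2)
  \tsum_(X111, X112 <- Delta Q X11)
  \tsum_(a, b <- \tsum_(f1, f2 <- twist_f Q)
     \tsum_(h1, h2 <- Delta Q (SV Q (alpha Q * Z3)))
     (SV Q f2 * h1) ⊗ (SV Q f1 * h2))
  F (Z1 * X10) (SV Q X3 * a * Z21 * X111) (SV Q X2 * b * Z22 * X112)).
rewrite_under twist_f_SV_alpha; rewrite /twist_gamma.
(* The twist is gone. The factor Phi^-1 of the gamma element combines with the two copies of Phi_rho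
   through the cocycle identity; only its factor Phi is left. *)
sweedler_with (fun qF => esym (@rho_cocycleE_PhiV _ _ _ _ C W
  (fun a b c d => \tsum_(Y1, Y2, Y3 <- Phi Q) \tsum_(b1, b2 <- Delta Q b)
    F a (SV Q (alpha Q * d) * Y1 * b1) (SV Q (alpha Q * Y3 * c) * Y2 * b2)) qF)).
sweedler_step (\tsum_(Z1, Z2, Z3 <- Phi_rho C) \tsum_(V1, V2, V3 <- Phi_rho C)
  \tsum_(V21, V22 <- Delta Q V2)
  \tsum_(a, b, c <- Phi Q *
    (\tsum_(p, q <- Delta Q Z2) \tsum_(r, s <- Delta Q p) r ⊗ s ⊗ q))
  F (Z1 * V1) (SV Q (alpha Q * Z3) * a * V21) (SV Q (alpha Q * c * V3) * b * V22)).
rewrite_under (self_quasi_coassoc Q).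
sweedler_step (\tsum_(Z1, Z2, Z3 <- Phi_rho C) \tsum_(V1, V2, V3 <- Phi_rho C)
  \tsum_(V21, V22 <- Delta Q V2) \tsum_(Y1, Y2, Y3 <- Phi Q)
  \tsum_(p, q <- Delta Q Z2)
  F (Z1 * V1) (SV Q (alpha Q * Z3) * p * Y1 * V21)
   (SV Q (Y3 * V3)
    * (\tsum_(q1, q2 <- Delta Q q) SV Q q2 * SV Q (alpha Q) * q1) * Y2 * V22)).
rewrite_under SV_antipode_alpha.
sweedler_step (\tsum_(Z1, Z2, Z3 <- Phi_rho C) \tsum_(V1, V2, V3 <- Phi_rho C)
  \tsum_(V21, V22 <- Delta Q V2) \tsum_(Y1, Y2, Y3 <- Phi Q)
  F (Z1 * V1)
   (SV Q (alpha Q * Z3) * (\tsum_(p, q <- Delta Q Z2) eps Q q *: p) * Y1 * V21)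
   (SV Q (Y3 * V3) * SV Q (alpha Q) * Y2 * V22)).
rewrite_under counitr.
(* The remaining Phi is absorbed by the cocycle identity, at the price of the Phi_rho^-1 on the
   right-hand side of the lemma. *)
sweedler_with (@rho_cocycleE_PhiV_rho _ _ _ _ C W
  (fun a b c d => \tsum_(Z1, Z2, Z3 <- Phi_rho C)
    F (Z1 * a) (SV Q (alpha Q * Z3) * Z2 * b) (SV Q (alpha Q * d) * c))).
sweedler_step (\tsum_(X1, X2, X3 <- Phi_rho C) \tsum_(V1, V2, V3 <- Phi_rho C)
  \tsum_(V10, V11 <- rho C V1) \tsum_(y1, y2, y3 <- PhiV_rho C)
  \tsum_(Z1, Z2, Z3 <- Phi_rho C)
  F (Z1 * X1 * V10 * y1) (SV Q (alpha Q * Z3) * Z2 * X2 * V11 * y2)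
   (SV Q V3 * (\tsum_(q1, q2 <- Delta Q X3) SV Q q2 * SV Q (alpha Q) * q1) * V2 * y3)).
rewrite_under SV_antipode_alpha.
sweedler_step (\tsum_(a, b <- \tsum_(a, g, h <- Phi_rho C) eps Q h *: (a ⊗ g))
  \tsum_(V1, V2, V3 <- Phi_rho C)
  \tsum_(V10, V11 <- rho C V1) \tsum_(y1, y2, y3 <- PhiV_rho C)
  \tsum_(Z1, Z2, Z3 <- Phi_rho C)
  F (Z1 * a * V10 * y1) (SV Q (alpha Q * Z3) * Z2 * b * V11 * y2)
   (SV Q (alpha Q * V3) * V2 * y3)).
rewrite_under (Phi_rho_counit3 C).
sweedler.
Qed.

End QTwist.

(** * Bicomodule algebras *)

Section Bicomodule.
Variables (k : fieldType) (H : algType k) (Q : quasiBialgebra H).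
Variables (A : algType k) (C : bicomoduleAlgebra Q A).

Lemma lr_compatV (u : A) :
  PhiV_lr C * (\tsum_(g, a <- lambda C u) g ⊗ rho C a) =
  (\tsum_(a, h <- rho C u) \tsum_(g, b <- lambda C a) g ⊗ b ⊗ h) * PhiV_lr C.
Proof.
have /(congr1 (fun t => PhiV_lr C * t * PhiV_lr C)) := lr_compat C u.
by rewrite !mulrA mulVPhi_lr mul1r -[RHS]mulrA mulPhiV_lr mulr1.
Qed.

Lemma lr_cocycle_leftE (W : lmodType k) (F : H -> H -> A -> H -> W) : quadlin F ->
  \tsum_(L1, L2, L3 <- Phi_lr C) \tsum_(M1, M2, M3 <- Phi_lr C)
  \tsum_(l, b <- lambda C M2) \tsum_(X1, X2, X3 <- Phi_lambda C)
    F (M1 * X1) (L1 * l * X2) (L2 * b * X3) (L3 * M3) =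
  \tsum_(X1, X2, X3 <- Phi_lambda C) \tsum_(b, l <- rho C X3)
  \tsum_(L1, L2, L3 <- Phi_lr C) \tsum_(h1, h2 <- Delta Q L1)
    F (X1 * h1) (X2 * h2) (b * L2) (l * L3).
Proof.
move=> qF.
have e := congr1 (fun t => \tsum_(a, b, c, d <- t) F a b c d) (lr_cocycle_left C).
by etransitivity; [|etransitivity; [exact: e|]];
  (rewrite !tsum4M; [sweedler | multilin ..]).
Qed.

Lemma lr_cocycle_rightE (W : lmodType k) (F : H -> A -> H -> H -> W) : quadlin F ->
  \tsum_(R1, R2, R3 <- Phi_rho C) \tsum_(L1, L2, L3 <- Phi_lr C)
  \tsum_(b, l <- rho C L2) \tsum_(M1, M2, M3 <- Phi_lr C)
    F (L1 * M1) (R1 * b * M2) (R2 * l * M3) (R3 * L3) =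
  \tsum_(L1, L2, L3 <- Phi_lr C) \tsum_(h1, h2 <- Delta Q L3)
  \tsum_(R1, R2, R3 <- Phi_rho C) \tsum_(l, b <- lambda C R1)
    F (L1 * l) (L2 * b) (h1 * R2) (h2 * R3).
Proof.
move=> qF.
have e := congr1 (fun t => \tsum_(a, b, c, d <- t) F a b c d) (lr_cocycle_right C).
by etransitivity; [|etransitivity; [exact: e|]];
  (rewrite !tsum4M; [sweedler | multilin ..]).
Qed.

(* (lambda ⊗ id ⊗ id)(Phi_rho) (Phi_lr^-1 ⊗ 1) (id ⊗ rho ⊗ id)(Phi_lr^-1) =
   (id ⊗ id ⊗ Delta)(Phi_lr^-1) (1 ⊗ Phi_rho) *)
Lemma lr_cocycle_rightVE (W : lmodType k) (F : H -> A -> H -> H -> W) : quadlin F ->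
  \tsum_(R1, R2, R3 <- Phi_rho C) \tsum_(l, b <- lambda C R1)
  \tsum_(t1, t2, t3 <- PhiV_lr C) \tsum_(s1, s2, s3 <- PhiV_lr C)
  \tsum_(c, m <- rho C s2)
    F (l * t1 * s1) (b * t2 * c) (R2 * t3 * m) (R3 * s3) =
  \tsum_(t1, t2, t3 <- PhiV_lr C) \tsum_(h1, h2 <- Delta Q t3)
  \tsum_(R1, R2, R3 <- Phi_rho C)
    F t1 (t2 * R1) (h1 * R2) (h2 * R3).
Proof.
move=> qF.
sweedler_step (\tsum_(v1, v2, v3 <- (1 : H ⊗ A ⊗ H)) \tsum_(h1, h2 <- Delta Q v3)
  \tsum_(R1, R2, R3 <- Phi_rho C) \tsum_(l, b <- lambda C R1)
  \tsum_(t1, t2, t3 <- PhiV_lr C) \tsum_(s1, s2, s3 <- PhiV_lr C)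
  \tsum_(c, m <- rho C s2)
    F (v1 * l * t1 * s1) (v2 * b * t2 * c) (h1 * R2 * t3 * m) (h2 * R3 * s3)).
(* The [Phi_lr] in this unit feeds the cocycle identity, read backwards; the two products
   [Phi_lr C * PhiV_lr C] that appear afterwards cancel in turn. *)
rewrite -(mulVPhi_lr C).
sweedler_with (fun qF => esym (@lr_cocycle_rightE W (fun a b c d =>
  \tsum_(v1, v2, v3 <- PhiV_lr C) \tsum_(h1, h2 <- Delta Q v3)
  \tsum_(t1, t2, t3 <- PhiV_lr C) \tsum_(s1, s2, s3 <- PhiV_lr C)
  \tsum_(g, m <- rho C s2)
    F (v1 * a * t1 * s1) (v2 * b * t2 * g) (h1 * c * t3 * m) (h2 * d * s3)) qF)).
sweedler_step (\tsum_(v1, v2, v3 <- PhiV_lr C) \tsum_(h1, h2 <- Delta Q v3)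
  \tsum_(R1, R2, R3 <- Phi_rho C) \tsum_(L1, L2, L3 <- Phi_lr C)
  \tsum_(b, l <- rho C L2)
  \tsum_(t1, t2, t3 <- Phi_lr C * PhiV_lr C) \tsum_(s1, s2, s3 <- PhiV_lr C)
  \tsum_(g, m <- rho C s2)
    F (v1 * L1 * t1 * s1) (v2 * R1 * b * t2 * g) (h1 * R2 * l * t3 * m)
      (h2 * R3 * L3 * s3)).
rewrite (mulPhiV_lr C).
sweedler_step (\tsum_(v1, v2, v3 <- PhiV_lr C) \tsum_(h1, h2 <- Delta Q v3)
  \tsum_(R1, R2, R3 <- Phi_rho C)
  \tsum_(s1, s2, s3 <- Phi_lr C * PhiV_lr C)
  \tsum_(g, m <- rho C s2)
    F (v1 * s1) (v2 * R1 * g) (h1 * R2 * m) (h2 * R3 * s3)).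
rewrite (mulPhiV_lr C).
sweedler.
Qed.

(** Let e be the left-hand side. The counit in the last two places of the right cocycle identity
    gives e e = e, and e is invertible because Phi_lr is. The sums below compute e^-1 e e in two
    ways. *)
Lemma Phi_lr_counit3 :
  (\tsum_(g, a, h <- Phi_lr C) eps Q h *: (g ⊗ a)) = 1 ⊗ 1.
Proof.
apply: tensor_ext => W G bG.
transitivity (\tsum_(v1, v2, v3 <- PhiV_lr C * Phi_lr C)
  \tsum_(L1, L2, L3 <- Phi_lr C) eps Q L3 *: (eps Q v3 *: G (v1 * L1) (v2 * L2))).
  by rewrite (mulVPhi_lr C); sweedler.
transitivity (\tsum_(r, c <- \tsum_(R1, R2, R3 <- Phi_rho C) eps Q R2 *: (R1 ⊗ R3))
  \tsum_(L1, L2, L3 <- Phi_lr C) \tsum_(M1, M2, M3 <- Phi_lr C)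
  \tsum_(v1, v2, v3 <- PhiV_lr C)
    eps Q (v3 * c * L3 * M3) *:
      G (v1 * L1 * M1) (v2 * r * (\tsum_(b, l <- rho C L2) eps Q l *: b) * M2)).
  by rewrite (Phi_rho_counit2 C); apply: esym; rewrite_under (rho_counit C); sweedler.
sweedler_with (@lr_cocycle_rightE W (fun a b c d => eps Q c *:
  (\tsum_(v1, v2, v3 <- PhiV_lr C) eps Q (v3 * d) *: G (v1 * a) (v2 * b)))).
sweedler_step (\tsum_(r, c <- \tsum_(R1, R2, R3 <- Phi_rho C) eps Q R2 *: (R1 ⊗ R3))
  \tsum_(L1, L2, L3 <- Phi_lr C) \tsum_(l, b <- lambda C r)
  \tsum_(v1, v2, v3 <- PhiV_lr C)
    eps Q (v3 * c) *: (eps Q (\tsum_(h1, h2 <- Delta Q L3) eps Q h1 *: h2) *: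
      G (v1 * L1 * l) (v2 * L2 * b))).
rewrite (Phi_rho_counit2 C); rewrite_under counitl.
sweedler_step (\tsum_(v1, v2, v3 <- PhiV_lr C * Phi_lr C) eps Q v3 *: G v1 v2).
by rewrite (mulVPhi_lr C); sweedler.
Qed.

(** The mirror argument: the counit in the first two places of the left cocycle identity, with the
    inverse multiplied on the right. *)
Lemma Phi_lr_counit1 :
  (\tsum_(g, a, h <- Phi_lr C) eps Q g *: (a ⊗ h)) = 1 ⊗ 1.
Proof.
apply: tensor_ext => W G bG.
transitivity (\tsum_(v1, v2, v3 <- Phi_lr C * PhiV_lr C)
  \tsum_(L1, L2, L3 <- Phi_lr C) eps Q L1 *: (eps Q v1 *: G (L2 * v2) (L3 * v3))).
  by rewrite (mulPhiV_lr C); sweedler.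
transitivity (\tsum_(r, c <- \tsum_(X1, X2, X3 <- Phi_lambda C) eps Q X2 *: (X1 ⊗ X3))
  \tsum_(L1, L2, L3 <- Phi_lr C) \tsum_(M1, M2, M3 <- Phi_lr C)
  \tsum_(v1, v2, v3 <- PhiV_lr C)
    eps Q (L1 * M1 * r * v1) *:
      G (L2 * (\tsum_(l, b <- lambda C M2) eps Q l *: b) * c * v2) (L3 * M3 * v3)).
  rewrite (Phi_lambda_counit2 C); apply: esym.
  by rewrite_under (lambda_counit C); sweedler.
sweedler_with (@lr_cocycle_leftE W (fun a b c d => eps Q b *:
  (\tsum_(v1, v2, v3 <- PhiV_lr C) eps Q (a * v1) *: G (c * v2) (d * v3)))).
sweedler_step (\tsum_(r, c <- \tsum_(X1, X2, X3 <- Phi_lambda C) eps Q X2 *: (X1 ⊗ X3))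
  \tsum_(L1, L2, L3 <- Phi_lr C) \tsum_(b, l <- rho C c)
  \tsum_(v1, v2, v3 <- PhiV_lr C)
    eps Q (r * v1) *: (eps Q (\tsum_(h1, h2 <- Delta Q L1) eps Q h2 *: h1) *:
      G (b * L2 * v2) (l * L3 * v3))).
rewrite (Phi_lambda_counit2 C); rewrite_under counitr.
sweedler_step (\tsum_(v1, v2, v3 <- Phi_lr C * PhiV_lr C) eps Q v1 *: G v2 v3).
by rewrite (mulPhiV_lr C); sweedler.
Qed.

Lemma PhiV_lr_counit1 :
  (\tsum_(g, a, h <- PhiV_lr C) eps Q g *: (a ⊗ h)) = 1 ⊗ 1.
Proof. exact: counit1_inv (mulPhiV_lr C) Phi_lr_counit1. Qed.

Lemma PhiV_lr_counit3 :
  (\tsum_(g, a, h <- PhiV_lr C) eps Q h *: (g ⊗ a)) = 1 ⊗ 1.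
Proof. exact: counit3_inv (mulPhiV_lr C) Phi_lr_counit3. Qed.

Lemma PhiV_lambda_counit1 :
  (\tsum_(g, h, a <- PhiV_lambda C) eps Q g *: (h ⊗ a)) = 1 ⊗ 1.
Proof. exact: counit1_inv (mulPhiV_lambda C) (Phi_lambda_counit1 C). Qed.

Lemma PhiV_lambda_counit2 :
  (\tsum_(g, h, a <- PhiV_lambda C) eps Q h *: (g ⊗ a)) = 1 ⊗ 1.
Proof. exact: counit2_inv (mulPhiV_lambda C) (Phi_lambda_counit2 C). Qed.

End Bicomodule.

(** * Counits of [Omega] *)

Section OmegaCounit.
Variables (k : fieldType) (H : algType k) (Q : quasiHopf H).
Variables (A : algType k) (C : bicomoduleAlgebra Q A).
Variables (W : lmodType k) (F : H -> A -> H -> W) (tF : trilin F).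

(** This governs products with right factor in the image of j: the second and fourth components of
    [Omega] act there on the unit [bone], hence through the counit. The next lemma serves left
    factors in the image of j in the same way. *)
Lemma Omega_counit24 :
  \tsum_(O1, O2, O3, O4, O5 <- Omega C) eps Q O2 *: (eps Q O4 *: F O1 O3 O5) =
  F 1 1 1.
Proof.
rewrite /Omega.
sweedler_step (\tsum_(X1, X3 <- \tsum_(a, g, h <- Phi_rho C) eps Q g *: (a ⊗ h))
  \tsum_(x1, x3 <- \tsum_(g, h, a <- PhiV_lambda C) eps Q h *: (g ⊗ a))
  \tsum_(t1, t2 <- \tsum_(g, a, h <- PhiV_lr C) eps Q h *: (g ⊗ a))
  \tsum_(X1m, X10 <- lambda C X1)
  F ((\tsum_(m1, m2 <- Delta Q X1m) eps Q m2 *: m1) * x1 * t1)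
    (X10 * x3 * (\tsum_(l, b <- lambda C t2) eps Q l *: b))
    (SV Q X3 * SV Q (\tsum_(f1, f2 <- twist_f Q) eps Q f1 *: f2))).
rewrite (Phi_rho_counit2 C) PhiV_lambda_counit2 PhiV_lr_counit3.
rewrite_under counitr; rewrite_under (lambda_counit C); rewrite_under twist_f_counit1.
sweedler.
Qed.

Lemma Omega_counit15 :
  \tsum_(O1, O2, O3, O4, O5 <- Omega C) eps Q O1 *: (eps Q O5 *: F O2 O3 O4) =
  F 1 1 1.
Proof.
rewrite /Omega.
sweedler_step (\tsum_(X1, X2 <- \tsum_(a, g, h <- Phi_rho C) eps Q h *: (a ⊗ g))
  \tsum_(x2, x3 <- \tsum_(g, h, a <- PhiV_lambda C) eps Q g *: (h ⊗ a))
  \tsum_(t2, t3 <- \tsum_(g, a, h <- PhiV_lr C) eps Q g *: (a ⊗ h))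
  \tsum_(X1m, X10 <- lambda C X1) \tsum_(t2m, t20 <- lambda C t2)
  F ((\tsum_(m1, m2 <- Delta Q X1m) eps Q m1 *: m2) * x2 * t2m)
    (X10 * x3 * t20)
    (SV Q (X2 * t3) * SV Q (\tsum_(f1, f2 <- twist_f Q) eps Q f2 *: f1))).
rewrite (Phi_rho_counit3 C) PhiV_lambda_counit1 PhiV_lr_counit1.
rewrite_under counitl; rewrite_under twist_f_counit2.
sweedler.
Qed.

End OmegaCounit.

(** * The universal property *)

Section UniversalMap.
Variables (k : fieldType) (H : algType k) (Q : quasiHopf H)
    (AA : lmodType k) (M : bimoduleAlgebra Q AA)
    (A : algType k) (C : bicomoduleAlgebra Q A)
    (B : algType k) (gamma : {lrmorphism A -> B}) (v : {linear AA -> B}).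
Hypothesis v_intertwine : forall (phi : AA) (u : A),
       (\tsum_(u0, u1 <- rho C u) gamma u0 * v (ract M phi u1)) =
       (\tsum_(um, u0 <- lambda C u) v (lact M um phi) * gamma u0).
Hypothesis v_mul : forall phi phi' : AA,
       v (bmul M phi phi') =
       \tsum_(X1, X2, X3 <- Phi_rho C)
       \tsum_(Y1, Y2, Y3 <- Phi_lambda C)
       \tsum_(t1, t2, t3 <- PhiV_lr C)
         gamma X1 * v (biact M (t1 * Y1) phi X2) * gamma t2
         * v (biact M Y2 phi' (X3 * t3)) * gamma Y3.

Let v_intertwineV (phi : AA) (u : A) := esym (v_intertwine phi u).

(** The formula for w on simple tensors, with [q_rho] written out so that the identities for
    [Phi_rho] apply directly. *)
Definition univ_form (phi : AA) (u : A) : B :=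
  \tsum_(X1, X2, X3 <- Phi_rho C)
    gamma X1 * v (ract M phi (SV Q (alpha Q * X3) * X2)) * gamma u.

Lemma univ_formE phi u :
  univ_form phi u =
  \tsum_(q1, q2 <- q_rho C) gamma q1 * v (ract M phi q2) * gamma u.
Proof. by rewrite /univ_form /q_rho; sweedler. Qed.

Lemma univ_form_bilin : bilin univ_form.
Proof. by rewrite /univ_form; multilin. Qed.

Lemma v_ract_bmul phi phi' h :
  v (ract M (bmul M phi phi') h) =
  \tsum_(X1, X2, X3 <- Phi_rho C) \tsum_(Y1, Y2, Y3 <- Phi_lambda C)
  \tsum_(t1, t2, t3 <- PhiV_lr C) \tsum_(h1, h2 <- Delta Q h)
    gamma X1 * v (biact M (t1 * Y1) phi (h1 * X2)) * gamma t2
         * v (biact M Y2 phi' (h2 * X3 * t3)) * gamma Y3.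
Proof.
rewrite ract_bmul.
sweedler_step (\tsum_(h1, h2 <- Delta Q h) v (bmul M (ract M phi h1) (ract M phi' h2))).
rewrite_under v_mul.
sweedler.
Qed.

Lemma univ_form_mul phi u phi' u' :
  \tsum_(O1, O2, O3, O4, O5 <- Omega C)
  \tsum_(u0, u1 <- rho C u) \tsum_(u0m, u00 <- lambda C u0)
    univ_form (bmul M (biact M O1 phi O5)
                 (biact M (O2 * u0m) phi' (SV Q u1 * O4)))
      (O3 * u00 * u') =
  univ_form phi u * univ_form phi' u'.
Proof.
rewrite /univ_form; rewrite_under v_ract_bmul; rewrite /Omega.
sweedler_step (\tsum_(Z1, Z2, Z3 <- Phi_rho C) \tsum_(Q1, Q2, Q3 <- Phi_rho C)
  \tsum_(X1, X2, X3 <- Phi_rho C)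
  \tsum_(f1, f2 <- twist_f Q)
  \tsum_(t1, t2, t3 <- PhiV_lr C) \tsum_(s1, s2, s3 <- PhiV_lr C)
  \tsum_(u0, u1 <- rho C u) \tsum_(u0m, u00 <- lambda C u0)
  \tsum_(m1, m2 <- Delta Q (SV Q (alpha Q * Q3) * Q2))
  \tsum_(t2m, t20 <- lambda C t2)
  \tsum_(y1, y2, y3 <- PhiV_lambda C)
  \tsum_(a, b, c <- Phi_lambda C *
     (\tsum_(h, a <- lambda C Z1) \tsum_(h1, h2 <- Delta Q h) h1 ⊗ h2 ⊗ a))
  gamma Q1 * gamma X1
  * v (biact M (s1 * a * y1 * t1) phi (SV Q (f2 * Z3) * m1 * X2))
  * gamma s2
  * v (biact M (b * y2 * t2m * u0m) phi'
        (SV Q u1 * SV Q (f1 * Z2 * t3) * m2 * X3 * s3))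
  * gamma (c * y3 * t20 * u00 * u')).
(* The Phi_lambda coming from [v_mul] passes lambda(Z^1) and meets the inverse contained in
   [Omega]. *)
rewrite_under (fun u => esym (lambda_quasi_coassoc C u)).
sweedler_step (\tsum_(Z1, Z2, Z3 <- Phi_rho C) \tsum_(Q1, Q2, Q3 <- Phi_rho C)
  \tsum_(X1, X2, X3 <- Phi_rho C)
  \tsum_(f1, f2 <- twist_f Q)
  \tsum_(t1, t2, t3 <- PhiV_lr C) \tsum_(s1, s2, s3 <- PhiV_lr C)
  \tsum_(u0, u1 <- rho C u) \tsum_(u0m, u00 <- lambda C u0)
  \tsum_(m1, m2 <- Delta Q (SV Q (alpha Q * Q3) * Q2))
  \tsum_(t2m, t20 <- lambda C t2)
  \tsum_(Zm, Z0 <- lambda C Z1) \tsum_(Z0m, Z00 <- lambda C Z0)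
  \tsum_(a, b, c <- Phi_lambda C * PhiV_lambda C)
  gamma Q1 * gamma X1
  * v (biact M (s1 * Zm * a * t1) phi (SV Q (f2 * Z3) * m1 * X2))
  * gamma s2
  * v (biact M (Z0m * b * t2m * u0m) phi'
        (SV Q u1 * SV Q (f1 * Z2 * t3) * m2 * X3 * s3))
  * gamma (Z00 * c * t20 * u00 * u')).
rewrite_under (mulPhiV_lambda C).
sweedler_step (\tsum_(Z1, Z2, Z3 <- Phi_rho C) \tsum_(Q1, Q2, Q3 <- Phi_rho C)
  \tsum_(X1, X2, X3 <- Phi_rho C)
  \tsum_(f1, f2 <- twist_f Q)
  \tsum_(t1, t2, t3 <- PhiV_lr C) \tsum_(s1, s2, s3 <- PhiV_lr C)
  \tsum_(u0, u1 <- rho C u)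
  \tsum_(m1, m2 <- Delta Q (SV Q (alpha Q * Q3) * Q2))
  \tsum_(Zm, Z0 <- lambda C Z1)
  gamma Q1 * gamma X1
  * v (biact M (s1 * Zm * t1) phi (SV Q (f2 * Z3) * m1 * X2))
  * gamma s2
  * (\tsum_(r, s <- lambda C (Z0 * t2 * u0))
     v (lact M r (ract M phi'
        (SV Q u1 * SV Q (f1 * Z2 * t3) * m2 * X3 * s3))) * gamma s)
  * gamma u').
(* All left coactions inside the second v now form one lambda(Z^1_[0] t^2 u_<0>), which is traded
   for a right coaction. *)
rewrite_under v_intertwineV.
sweedler_step (\tsum_(Z1, Z2, Z3 <- Phi_rho C) \tsum_(Q1, Q2, Q3 <- Phi_rho C)
  \tsum_(X1, X2, X3 <- Phi_rho C)
  \tsum_(f1, f2 <- twist_f Q)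
  \tsum_(t1, t2, t3 <- PhiV_lr C)
  \tsum_(u0, u1 <- rho C u) \tsum_(u00, u01 <- rho C u0)
  \tsum_(m1, m2 <- Delta Q (SV Q (alpha Q * Q3) * Q2))
  \tsum_(t20, t21 <- rho C t2)
  \tsum_(a, b, c <- PhiV_lr C * (\tsum_(g, a <- lambda C Z1) g ⊗ rho C a))
  gamma Q1 * gamma X1
  * v (biact M (a * t1) phi (SV Q (f2 * Z3) * m1 * X2))
  * gamma (b * t20 * u00)
  * v (ract M phi' (SV Q u1 * SV Q (f1 * Z2 * t3) * m2 * X3 * c * t21 * u01))
  * gamma u').
rewrite_under lr_compatV.
sweedler_step (\tsum_(Z1, Z2, Z3 <- Phi_rho C) \tsum_(Q1, Q2, Q3 <- Phi_rho C)
  \tsum_(X1, X2, X3 <- Phi_rho C)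
  \tsum_(f1, f2 <- twist_f Q)
  \tsum_(s1, s2, s3 <- PhiV_lr C) \tsum_(t1, t2, t3 <- PhiV_lr C)
  \tsum_(u0, u1 <- rho C u) \tsum_(u00, u01 <- rho C u0)
  \tsum_(m1, m2 <- Delta Q (SV Q (alpha Q * Q3) * Q2))
  \tsum_(t20, t21 <- rho C t2) \tsum_(Z10, Z11 <- rho C Z1)
  gamma Q1 * gamma X1
  * (\tsum_(r, s <- lambda C Z10)
     v (lact M r (biact M (s1 * t1) phi (SV Q (f2 * Z3) * m1 * X2))) * gamma s)
  * gamma (s2 * t20 * u00)
  * v (ract M phi' (SV Q u1 * SV Q (f1 * Z2 * t3) * m2 * X3 * Z11 * s3 * t21 * u01))
  * gamma u').
(* Now that Phi_lr^-1 has passed the coactions of Z^1, the same exchange applies to the first v. *)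
rewrite_under v_intertwineV.
sweedler_step (\tsum_(Q1, Q2, Q3 <- Phi_rho C) \tsum_(Z1, Z2, Z3 <- Phi_rho C)
  \tsum_(f1, f2 <- twist_f Q)
  \tsum_(s1, s2, s3 <- PhiV_lr C) \tsum_(t1, t2, t3 <- PhiV_lr C)
  \tsum_(u0, u1 <- rho C u) \tsum_(u00, u01 <- rho C u0)
  \tsum_(m1, m2 <- Delta Q (SV Q (alpha Q * Q3) * Q2))
  \tsum_(t20, t21 <- rho C t2)
  \tsum_(a, b, c <- Phi_rho C *
     (\tsum_(a, h <- rho C Z1) \tsum_(b, g <- rho C a) b ⊗ g ⊗ h))
  gamma (Q1 * a)
  * v (biact M (s1 * t1) phi (SV Q (f2 * Z3) * m1 * b))
  * gamma (s2 * t20 * u00)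
  * v (ract M phi' (SV Q u1 * SV Q (f1 * Z2 * t3) * m2 * c * s3 * t21 * u01))
  * gamma u').
rewrite_under (rho_quasi_coassoc C).
(* Once Phi_rho has passed the double coaction of Z^1, the twist occurs exactly as in [q_rho_twist];
   the resulting Phi_rho^-1 cancels against this Phi_rho. *)
sweedler_with (@q_rho_twist _ _ _ _ C B (fun a b c =>
  \tsum_(X1, X2, X3 <- Phi_rho C)
  \tsum_(s1, s2, s3 <- PhiV_lr C) \tsum_(t1, t2, t3 <- PhiV_lr C)
  \tsum_(u0, u1 <- rho C u) \tsum_(u00, u01 <- rho C u0)
  \tsum_(t20, t21 <- rho C t2)
  gamma (a * X1)
  * v (biact M (s1 * t1) phi (b * X2))
  * gamma (s2 * t20 * u00)
  * v (ract M phi' (SV Q u1 * SV Q t3 * c * X3 * s3 * t21 * u01))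
  * gamma u')).
sweedler_step (\tsum_(Q1, Q2, Q3 <- Phi_rho C) \tsum_(R1, R2, R3 <- Phi_rho C)
  \tsum_(R10, R11 <- rho C R1)
  \tsum_(s1, s2, s3 <- PhiV_lr C) \tsum_(t1, t2, t3 <- PhiV_lr C)
  \tsum_(u0, u1 <- rho C u) \tsum_(u00, u01 <- rho C u0)
  \tsum_(t20, t21 <- rho C t2)
  \tsum_(a, b, c <- PhiV_rho C * Phi_rho C)
  gamma (Q1 * R10 * a)
  * v (biact M (s1 * t1) phi (SV Q (alpha Q * Q3) * Q2 * R11 * b))
  * gamma (s2 * t20 * u00)
  * v (ract M phi' (SV Q u1 * SV Q t3 * SV Q (alpha Q * R3) * R2 * c
       * s3 * t21 * u01))
  * gamma u').
rewrite_under (mulVPhi_rho C).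
sweedler_step (\tsum_(Q1, Q2, Q3 <- Phi_rho C) \tsum_(R1, R2, R3 <- Phi_rho C)
  \tsum_(s1, s2, s3 <- PhiV_lr C) \tsum_(t1, t2, t3 <- PhiV_lr C)
  \tsum_(u0, u1 <- rho C u) \tsum_(u00, u01 <- rho C u0)
  \tsum_(t20, t21 <- rho C t2)
  gamma Q1
  * (\tsum_(r, s <- rho C R1) gamma r
      * v (ract M (biact M (s1 * t1) phi (SV Q (alpha Q * Q3) * Q2)) s))
  * gamma (s2 * t20 * u00)
  * v (ract M phi' (SV Q u1 * SV Q t3 * SV Q (alpha Q * R3) * R2 * s3 * t21 * u01))
  * gamma u').
(* Turning rho(R^1) into lambda(R^1) prepares the mixed cocycle identity, which merges the two
   copies of Phi_lr^-1 into one. *)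
rewrite_under v_intertwine.
sweedler_with (@lr_cocycle_rightVE _ _ _ _ C B (fun a b c d =>
  \tsum_(Q1, Q2, Q3 <- Phi_rho C) \tsum_(u0, u1 <- rho C u)
  \tsum_(u00, u01 <- rho C u0)
  gamma Q1 * v (biact M a phi (SV Q (alpha Q * Q3) * Q2)) * gamma (b * u00)
  * v (ract M phi' (SV Q u1 * SV Q (alpha Q * d) * c * u01)) * gamma u')).
sweedler_step (\tsum_(s1, s2, s3 <- PhiV_lr C) \tsum_(R1, R2, R3 <- Phi_rho C)
  \tsum_(Q1, Q2, Q3 <- Phi_rho C) \tsum_(u0, u1 <- rho C u)
  \tsum_(u00, u01 <- rho C u0)
  gamma Q1 * v (biact M s1 phi (SV Q (alpha Q * Q3) * Q2))
  * gamma (s2 * R1 * u00)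
  * v (ract M phi' (SV Q u1 * SV Q R3
      * (\tsum_(h1, h2 <- Delta Q s3) SV Q h2 * SV Q (alpha Q) * h1)
      * R2 * u01)) * gamma u').
(* S^-1(alpha) contracts the third leg of Phi_lr^-1 to its counit, so that Phi_lr^-1 disappears;
   below, the coaction of u is removed in the same way. *)
rewrite_under SV_antipode_alpha.
sweedler_step (\tsum_(s1, s2 <- \tsum_(g, a, h <- PhiV_lr C) eps Q h *: (g ⊗ a))
  \tsum_(Q1, Q2, Q3 <- Phi_rho C)
  \tsum_(a, b, c <- Phi_rho C *
     (\tsum_(a, h <- rho C u) \tsum_(b, g <- rho C a) b ⊗ g ⊗ h))
  gamma Q1 * v (biact M s1 phi (SV Q (alpha Q * Q3) * Q2))
  * gamma (s2 * a)
  * v (ract M phi' (SV Q (alpha Q * c) * b)) * gamma u').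
rewrite_under (PhiV_lr_counit3 C); rewrite_under (rho_quasi_coassoc C).
sweedler_step (\tsum_(Q1, Q2, Q3 <- Phi_rho C) \tsum_(R1, R2, R3 <- Phi_rho C)
  \tsum_(u0, u1 <- rho C u)
  gamma Q1 * v (ract M phi (SV Q (alpha Q * Q3) * Q2)) * gamma (u0 * R1)
  * v (ract M phi' (SV Q R3
      * (\tsum_(h1, h2 <- Delta Q u1) SV Q h2 * SV Q (alpha Q) * h1) * R2))
  * gamma u').
rewrite_under SV_antipode_alpha.
sweedler_step (\tsum_(Q1, Q2, Q3 <- Phi_rho C) \tsum_(R1, R2, R3 <- Phi_rho C)
  gamma Q1 * v (ract M phi (SV Q (alpha Q * Q3) * Q2))
  * gamma ((\tsum_(u0, u1 <- rho C u) eps Q u1 *: u0) * R1)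
  * v (ract M phi' (SV Q (alpha Q * R3) * R2))
  * gamma u').
rewrite_under (rho_counit C).
sweedler.
Qed.

(** The intertwining relation turns lambda(p^1) into rho(p^1), and [pq_rho] applies. *)
Lemma univ_form_Gamma phi :
  tsum (dcp_Gamma M C phi) univ_form = v phi.
Proof.
have bf : bilin univ_form := univ_form_bilin.
rewrite /dcp_Gamma /p_rho /dcp.
sweedler_step (\tsum_(x1, x2, x3 <- PhiV_rho C) \tsum_(p1m, p10 <- lambda C x1)
  univ_form (biact M p1m phi (SV Q (x2 * beta Q * S Q x3))) p10).
rewrite /univ_form.
sweedler_step (\tsum_(X1, X2, X3 <- Phi_rho C) \tsum_(x1, x2, x3 <- PhiV_rho C)
  gamma X1 * (\tsum_(r, s <- lambda C x1)
   v (lact M r (ract M phi (SV Q (alpha Q * X3 * x2 * beta Q * S Q x3) * X2)))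
   * gamma s)).
rewrite_under v_intertwineV.
transitivity (gamma 1 * v (ract M phi 1)); last by rewrite rmorph1 mul1r ract1.
rewrite -(@pq_rho _ _ _ _ C _ (fun a b => gamma a * v (ract M phi b))); last multilin.
sweedler.
Qed.

Lemma univ_form_one (v_one : v (bone M) = 1) u : univ_form (bone M) u = gamma u.
Proof.
rewrite /univ_form; rewrite_under ract_bone.
sweedler_step (\tsum_(a, b <- \tsum_(X1, X2, X3 <- Phi_rho C) eps Q X2 *: (X1 ⊗ X3))
  eps Q b *: (gamma a * v (bone M) * gamma u)).
by rewrite (Phi_rho_counit2 C) v_one; sweedler.
Qed.

End UniversalMap.

(** * Products with the image of j in the crossed product *)

Section CrossedProduct.
Variables (k : fieldType) (H : algType k) (Q : quasiHopf H)
    (AA : lmodType k) (M : bimoduleAlgebra Q AA)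
    (A : algType k) (C : bicomoduleAlgebra Q A).

Lemma biact_bone g h : biact M g (bone M) h = eps Q g *: (eps Q h *: bone M).
Proof.
by rewrite /biact lact_bone (bilinZl _ _ _ (ract_bilin M)) ract_bone.
Qed.

Lemma dcp_mul_bilin : bilin (dcp_mul M C).
Proof. by rewrite /dcp_mul /dcp; multilin. Qed.

Lemma dcp_mul_jr (phi : AA) (u u' : A) :
  dcp_mul M C (phi ⊗ u) (dcp_j M u') = phi ⊗ (u * u').
Proof.
rewrite /dcp_mul /dcp_j /dcp.
sweedler_step (\tsum_(O1, O2, O3, O4, O5 <- Omega C)
  \tsum_(u0, u1 <- rho C u) \tsum_(u0m, u00 <- lambda C u0)
    bmul M (biact M O1 phi O5)
           (biact M (O2 * u0m) (bone M) (SV Q u1 * O4))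
      ⊗ (O3 * u00 * u')).
rewrite_under biact_bone.
transitivity (\tsum_(O1, O2, O3, O4, O5 <- Omega C) eps Q O2 *: (eps Q O4 *:
  \tsum_(u0, u1 <- rho C u) \tsum_(u0m, u00 <- lambda C u0)
    eps Q u0m *: (eps Q u1 *:
    (bmul M (biact M O1 phi O5) (bone M) ⊗ (O3 * u00 * u'))))).
  by sweedler.
rewrite_under bmul1r.
rewrite (@Omega_counit24 _ _ _ _ C _ (fun O1 O3 O5 =>
  \tsum_(u0, u1 <- rho C u) \tsum_(u0m, u00 <- lambda C u0)
    eps Q u0m *: (eps Q u1 *: (biact M O1 phi O5 ⊗ (O3 * u00 * u'))))); last multilin.
sweedler_step (biact M 1 phi 1 ⊗
  ((\tsum_(r, s <- lambda C (\tsum_(u0, u1 <- rho C u) eps Q u1 *: u0)) eps Q r *: s)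
   * u')).
by rewrite lambda_counit rho_counit; sweedler.
Qed.

Lemma dcp_mul_jl (u : A) (phi : AA) (u' : A) :
  dcp_mul M C (dcp_j M u) (phi ⊗ u') =
  \tsum_(u0, u1 <- rho C u) \tsum_(u0m, u00 <- lambda C u0)
     biact M u0m phi (SV Q u1) ⊗ (u00 * u').
Proof.
rewrite /dcp_mul /dcp_j /dcp.
sweedler_step (\tsum_(O1, O2, O3, O4, O5 <- Omega C)
  \tsum_(u0, u1 <- rho C u) \tsum_(u0m, u00 <- lambda C u0)
    bmul M (biact M O1 (bone M) O5)
           (biact M (O2 * u0m) phi (SV Q u1 * O4))
      ⊗ (O3 * u00 * u')).
rewrite_under biact_bone.
sweedler_step (\tsum_(O1, O2, O3, O4, O5 <- Omega C)
  \tsum_(u0, u1 <- rho C u) \tsum_(u0m, u00 <- lambda C u0)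
    eps Q O1 *: (eps Q O5 *:
    (bmul M (bone M) (biact M (O2 * u0m) phi (SV Q u1 * O4))
      ⊗ (O3 * u00 * u')))).
rewrite_under bmul1l.
transitivity (\tsum_(O1, O2, O3, O4, O5 <- Omega C) eps Q O1 *: (eps Q O5 *:
  \tsum_(u0, u1 <- rho C u) \tsum_(u0m, u00 <- lambda C u0)
    (biact M (O2 * u0m) phi (SV Q u1 * O4) ⊗ (O3 * u00 * u')))).
  by sweedler.
rewrite (@Omega_counit15 _ _ _ _ C _ (fun O2 O3 O4 =>
  \tsum_(u0, u1 <- rho C u) \tsum_(u0m, u00 <- lambda C u0)
    (biact M (O2 * u0m) phi (SV Q u1 * O4) ⊗ (O3 * u00 * u')))); last multilin.
sweedler.
Qed.

(** By the product formulas with j, phi is acted on from the right by S^-1(q^1_<1> p^2 S(q^2)) and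
    from the left through lambda(q^1_<0> p^1), so [qp_rho] reduces both to 1. *)
Lemma dcp_decomp (phi : AA) (u : A) :
  \tsum_(X1, X2, X3 <- Phi_rho C)
    dcp_mul M C (dcp_j M X1)
      (dcp_mul M C (dcp_Gamma M C (ract M phi (SV Q (alpha Q * X3) * X2)))
        (dcp_j M u)) = phi ⊗ u.
Proof.
have bm := dcp_mul_bilin.
rewrite /dcp_Gamma /p_rho /dcp.
sweedler_step (\tsum_(X1, X2, X3 <- Phi_rho C) \tsum_(x1, x2, x3 <- PhiV_rho C)
  \tsum_(p1m, p10 <- lambda C x1)
  dcp_mul M C (dcp_j M X1) (dcp_mul M C
   (biact M p1m (ract M phi (SV Q (alpha Q * X3) * X2)) (SV Q (x2 * beta Q * S Q x3))
    ⊗ p10) (dcp_j M u))).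
rewrite_under dcp_mul_jr; rewrite_under dcp_mul_jl.
transitivity ((fun a b => \tsum_(r, s <- lambda C a)
  biact M r phi (SV Q b) ⊗ (s * u)) 1 1); last sweedler.
rewrite -(@qp_rho _ _ _ _ C _ (fun a b => \tsum_(r, s <- lambda C a)
  biact M r phi (SV Q b) ⊗ (s * u))); last multilin.
sweedler.
Qed.

End CrossedProduct.

Theorem proposition7p2 (k : fieldType) (H : algType k) (Q : quasiHopf H)
    (AA : lmodType k) (M : bimoduleAlgebra Q AA)
    (A : algType k) (C : bicomoduleAlgebra Q A)
    (B : algType k) (gamma : {lrmorphism A -> B}) (v : {linear AA -> B})
    (v_intertwine : forall (phi : AA) (u : A),
       (\tsum_(u0, u1 <- rho C u) gamma u0 * v (ract M phi u1)) =
       (\tsum_(um, u0 <- lambda C u) v (lact M um phi) * gamma u0))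
    (v_mul : forall phi phi' : AA,
       v (bmul M phi phi') =
       \tsum_(X1, X2, X3 <- Phi_rho C)
       \tsum_(Y1, Y2, Y3 <- Phi_lambda C)
       \tsum_(t1, t2, t3 <- PhiV_lr C)
         gamma X1 * v (biact M (t1 * Y1) phi X2) * gamma t2
         * v (biact M Y2 phi' (X3 * t3)) * gamma Y3)
    (v_one : v (bone M) = 1) :
  exists w : dcp AA A -> B,
    unique (fun w' : dcp AA A -> B =>
              [/\ dcp_alg_map M C w',
                  forall phi : AA, w' (dcp_Gamma M C phi) = v phi
                & forall u : A, w' (dcp_j M u) = gamma u]) w
    /\ forall (phi : AA) (u : A),
         w (phi ⊗ u) =
         \tsum_(q1, q2 <- q_rho C) gamma q1 * v (ract M phi q2) * gamma u.
Proof.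
pose form := univ_form M C gamma v.
have bf : bilin form := univ_form_bilin M C gamma v.
have formE := @univ_form_mul _ _ _ _ M _ C _ gamma v v_intertwine v_mul.
pose w (t : dcp AA A) : B := tsum t form.
have w_j u : w (dcp_j M u) = gamma u.
  by rewrite /w /dcp_j tsum_tens// [LHS]univ_form_one.
exists w; split; last by move=> phi u; rewrite /w tsum_tens// [LHS]univ_formE.
split.
  split=> [|phi|//]; last by rewrite /w univ_form_Gamma.
  split; first exact: tsum_linear.
    exact: etrans (w_j 1) (rmorph1 gamma).
  move=> x y; rewrite /w /dcp_mul.
  (* Linearity of w carries it through the sums of the product, which leaves multiplicativity on
     simple tensors. *)
  sweedler_step (\tsum_(phi, u <- x) \tsum_(phi', u' <- y)
    \tsum_(O1, O2, O3, O4, O5 <- Omega C)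
    \tsum_(u0, u1 <- rho C u) \tsum_(u0m, u00 <- lambda C u0)
      form (bmul M (biact M O1 phi O5)
                   (biact M (O2 * u0m) phi' (SV Q u1 * O4)))
        (O3 * u00 * u')).
  rewrite_under formE.
  sweedler.
(* Uniqueness: t is a sum of simple tensors, and [dcp_decomp] writes each of them through the images
   of j and Gamma, on which w' is prescribed. *)
move=> w' [[lw' _ w'M] w'G w'j].
apply: boolp.funext => t; rewrite /w [in RHS](tensor_sum t).
rewrite (tsum_lin (K := w')) //; apply: eq_tsum => phi u.
rewrite -(dcp_decomp M C) (tsum_lin (K := w')) //.
apply: eq_tsum => X1 t'; rewrite (tsum_lin (K := w')) //.
by apply: eq_tsum => X2 X3; rewrite !w'M w'G !w'j mulrA.
Qed.
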